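(* Let $p,q\ge1$ be relatively prime integers and $n=p+q$. For each $m\in\mathbb{Z}$: (i) the algebraic function $\zeta\mapsto\left[\mathcal{F}_{p,q}^{(q;0)}(\tfrac{m}q;\zeta)\right]^q$ is uniformized by $\mathcal{C}_{p,q}^{(q;\mathrm{cycl.})}$; (ii) the algebraic function $\zeta\mapsto\left[\mathcal{F}_{p,q}^{(n;0)}(\tfrac{m}n;\zeta^{-1})\right]^n$ is uniformized by $\mathcal{C}_{p,q}^{(n;\mathrm{cycl.})}$.
   Context: Hypergeometric functions: $$\mathcal{F}_{p,q}^{(q;0)}(a;\zeta)={}_nF_{n-1}\left(\begin{array}{l}\frac{a}n,\dots,\frac{a+(n-1)}n\\ \frac{a+1}p,\dots,\frac{a+p}p;\ \frac1q,\dots,\frac{q-1}q\end{array}\mid\zeta\right),\quad \mathcal{F}_{p,q}^{(n;0)}(a;\zeta)={}_nF_{n-1}\left(\begin{array}{l}\frac{-a}p,\dots,\frac{-a+(p-1)}p;\ \frac{a}q,\dots,\frac{a+(q-1)}q\\ \frac1n,\dots,\frac{n-1}n\end{array}\mid\zeta\right),$$ power series near $0$; if (in the first) a lower parameter is a non-positive integer $-m_1$ and an upper parameter is an integer $-m_2$ with $-m_1\le-m_2\le0$, the function is defined as the limit of $\mathcal{F}_{p,q}^{(q;0)}(a';\zeta)$ as $a'\to a$. Schwarz curves (over $\mathbb{C}$): for $2\le k\le n$, $\mathcal{C}^{(k)}_{p,q}\subset\mathbb{P}^{k-1}$ is the irreducible curve that is the closure of the set of all $[x_1:\ldots:x_k]$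 such that $x_1,\dots,x_k$ (not all zero) are $k$ of the $n$ roots (with multiplicity) of some trinomial $x^n-g\,x^p-\beta$, $g,\beta\in\mathbb{C}$ not both zero. The function $\zeta=(-1)^q\frac{n^n}{p^pq^q}\frac{\beta^q}{g^n}$ belongs to its function field and gives a covering $\mathcal{C}^{(k)}_{p,q}\to\mathbb{P}^1_\zeta$. The group $\mathfrak{C}_k$ of cyclic permutations of $x_1,\dots,x_k$ acts on $\mathcal{C}^{(k)}_{p,q}$ over $\mathbb{P}^1_\zeta$, and $\mathcal{C}_{p,q}^{(k;\mathrm{cycl.})}=\mathcal{C}_{p,q}^{(k)}/\mathfrak{C}_k$ is the curve (up to birational equivalence) whose function field is the subfield of $\mathfrak{C}_k$-invariant functions. For $k=1$ the group is trivial and $\mathcal{C}_{p,q}^{(1;\mathrm{cycl.})}=\mathcal{C}_{p,q}^{(1)}=\mathbb{P}^1_s$ with covering $\zeta=(-1)^q\frac{n^n}{p^pq^q}\frac{s^q}{(1-s)^n}$. An algebraic function $F$ of $\zeta$ is uniformized by a curve $X$ covering $\mathbb{P}^1_\zeta$ if it becomes single-valued on $X$: there is an element of the function field of $X$ that agrees with $F(\zeta)$ near a suitable point of $X$ lying over the base point of the expansion ($\zeta=0$ in (i), $\zeta=\infty$ in (ii)). *)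

(* Defs.v *)
From mathcomp Require Import all_boot all_order all_fingroup all_algebra.
From mathcomp Require Import all_classical all_reals all_analysis.
From mathcomp Require Import complex.
(* The notations of mpoly clash with those of mathcomp-analysis. *)
From mathcomp Require Import -(notations) mpoly.
Set Implicit Arguments.
Unset Strict Implicit.
Unset Printing Implicit Defensive.
Import Order.TTheory GRing.Theory Num.Theory numFieldNormedType.Exports.
Local Open Scope classical_set_scope.
Local Open Scope ring_scope.

(* Packing R[i] as a numClosedFieldType makes the norm topology of numeric
   fields canonical on it. *)
Definition Cplx (R : realType) : numClosedFieldType := R[i].

Section Hypergeometric.
Variable C : numClosedFieldType.
Implicit Types (us ls : seq C) (a z : C).

Definition pochhammer a (k : nat) : C := \prod_(i < k) (a + i%:R).

Definition hypergeom_coef us ls (k : nat) : C :=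
  (\prod_(u <- us) pochhammer u k) /
  ((\prod_(l <- ls) pochhammer l k) * k`!%:R).

Definition hypergeom us ls z : C :=
  limn (series (fun k => hypergeom_coef us ls k * z ^+ k)).

(* A lower parameter -m1 and an upper parameter -m2 with -m1 <= -m2 <= 0. *)
Definition degenerate us ls : Prop :=
  exists m1 m2 : nat,
    [/\ - m1%:R \in ls, - m2%:R \in us & (m2 <= m1)%N].

Definition Fq_upper (p q : nat) a : seq C :=
  [seq (a + i%:R) / (p + q)%:R | i <- iota 0 (p + q)].

Definition Fq_lower (p q : nat) a : seq C :=
  [seq (a + i%:R) / p%:R | i <- iota 1 p] ++
  [seq i%:R / q%:R | i <- iota 1 q.-1].

Definition Fq (p q : nat) a z : C :=
  let F b := hypergeom (Fq_upper p q b) (Fq_lower p q b) z in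
  if `[< degenerate (Fq_upper p q a) (Fq_lower p q a) >]
  then lim (F b @[b --> a^'])
  else F a.

Definition Fn_upper (p q : nat) a : seq C :=
  [seq (- a + i%:R) / p%:R | i <- iota 0 p] ++
  [seq (a + i%:R) / q%:R | i <- iota 0 q].

Definition Fn_lower (p q : nat) : seq C :=
  [seq i%:R / (p + q)%:R | i <- iota 1 (p + q).-1].

Definition Fn (p q : nat) a z : C :=
  hypergeom (Fn_upper p q a) (Fn_lower p q) z.

End Hypergeometric.

Section Curves.
Variable C : numClosedFieldType.

(* A curve in P^(dim - 1), given by its affine cone without the origin.  The
   covering map to the z-line is given by its graph [cv_map], in which finitely
   many points of the curve may be missing, in particular those over infinity.
   The group [cv_group] permutes the homogeneous coordinates. *)
Record curve := Curve {
  cv_dim : nat;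
  cv_cone : set ('I_cv_dim -> C);
  cv_map : ('I_cv_dim -> C) -> C -> Prop;
  cv_group : {set 'S_cv_dim} }.

Arguments cv_cone : clear implicits.
Arguments cv_map : clear implicits.
Arguments cv_group : clear implicits.

(* [num]/[den] is an element of the function field of X/(cv_group X): X being
   irreducible, a fraction of forms of the same degree whose denominator does
   not vanish identically on X. *)
Definition function_on_quotient (X : curve) (num den : mpoly (cv_dim X) C) :=
  [/\ exists d : nat, (num \is ishomog1 d mdeg) /\ (den \is ishomog1 d mdeg),
      exists2 x, cv_cone X x & meval x den != 0
    & forall (s : 'S_(cv_dim X)) x, s \in cv_group X -> cv_cone X x ->
        meval (x \o s) num * meval x den = meval x num * meval (x \o s) den].

Definition analytic0 (f : C -> C) : Prop :=
  exists c : nat -> C,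
    \forall t \near (0 : C), series (fun k => c k * t ^+ k) @ \oo --> f t.

(* A holomorphic local coordinate at a point of the smooth model of X: an
   analytic arc in X, injective as a map to projective space. *)
Definition local_chart (X : curve) (x : C -> 'I_(cv_dim X) -> C) : Prop :=
  [/\ forall i, analytic0 (x ^~ i),
      \forall t \near (0 : C), cv_cone X (x t)
    & \forall s \near (0 : C) & t \near (0 : C),
        forall l, (forall i, x s i = l * x t i) -> s = t].

(* F becomes single-valued on X/(cv_group X).  [base] is the filter of punctured
   neighbourhoods of the base point in the projective line.  Each point of the
   quotient is the image of a point of X, and a function on the quotient agrees
   with F near the former if and only if it does near the latter. *)
Definition uniformized_by (F : C -> C) (base : set_system C) (X : curve) :=
  exists num den : mpoly (cv_dim X) C, function_on_quotient num den /\
  exists x : C -> 'I_(cv_dim X) -> C, local_chart x /\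
  exists2 z : C -> C, z t @[t --> (0 : C)^'] --> base &
    \forall t \near (0 : C)^',
      [/\ cv_map X (x t) (z t), meval (x t) den != 0
        & meval (x t) num / meval (x t) den = F (z t)].

Definition at_zero : set_system C := (0 : C)^'.
Definition at_infinity : set_system C := w^-1 @[w --> (0 : C)^'].

End Curves.

Arguments at_zero : clear implicits.
Arguments at_infinity : clear implicits.

Section Schwarz.
Variable C : numClosedFieldType.
Variables p q : nat.

Definition trinomial (g b : C) : {poly C} := 'X^(p + q) - g *: 'X^p - b%:P.

(* The x_i are roots of the trinomial, with multiplicity. *)
Definition trinomial_roots k (g b : C) (x : 'I_k -> C) : Prop :=
  exists r : seq C,
    trinomial g b = (\prod_i ('X - (x i)%:P)) * \prod_(y <- r) ('X - y%:P).

Definition schwarz_points k : set ('I_k -> C) :=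
  [set x | (exists i, x i != 0) /\
     exists g b, (g != 0) || (b != 0) /\ trinomial_roots g b x].

(* The Zariski closure in projective space. *)
Definition schwarz_cone k : set ('I_k -> C) :=
  [set x | (exists i, x i != 0) /\
     forall (d : nat) (P : mpoly k C), P \is ishomog1 d mdeg ->
       (forall y, schwarz_points y -> meval y P = 0) -> meval x P = 0].

Definition zeta_of (b g : C) : C :=
  (-1) ^+ q * ((p + q) ^ (p + q))%:R / (p ^ p * q ^ q)%:R
    * (b ^+ q / g ^+ (p + q)).

(* For k >= 2 the x_i, which are not all zero, determine g and b. *)
Definition schwarz_cover k (x : 'I_k -> C) (z : C) : Prop :=
  exists g b, [/\ g != 0, trinomial_roots g b x & z = zeta_of b g].

Definition cyclic_shift k : 'S_k := perm (@ordS_inj k).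

(* The projective line, with affine coordinate s = x_0 / x_1. *)
Definition line_cover (x : 'I_2 -> C) (z : C) : Prop :=
  [/\ x ord_max != 0, x ord0 / x ord_max != 1
    & let s := x ord0 / x ord_max in z = zeta_of s (1 - s)].

(* The quotient of C_{p,q}^(k) by its cyclic group. *)
Definition schwarz_cycl (k : nat) : curve C :=
  if (k == 1)%N then
    Curve [set x | exists i, x i != 0] line_cover [set 1%g]
  else
    Curve (@schwarz_cone k) (@schwarz_cover k) <[cyclic_shift k]>%g.

End Schwarz.

(* Main.v *)
(* Let A_r(t) be the generalized binomial series, whose k-th coefficient is
   r (r + k tau - 1) ... (r + k tau - k + 1) / k!.  The Rothe-Hagen identity
   gives A_r A_s = A_(r+s), and moreover A_1 = 1 + t A_tau.  So for tau = e / k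
   the function X = A_(1/k) solves X^k = 1 + t X^e and satisfies X^m = A_(m/k).
   Take (k, e) = (q, -p) for the roots of x^n - x^p - t near the q-th roots of
   unity, and (k, e) = (n, p) for the roots of x^n - t x^p - 1.  In both cases
   the roots are x_j = w^j X(w'^j t), where w and w' are primitive k-th roots of
   unity with w' = w^e.  Averaging X^(-m) over the points w'^j t keeps the
   coefficients of A_(-m/k) with index divisible by k, which are those of the
   hypergeometric series in zeta or 1/zeta.  Hence the latter equals
   (1/k) sum_j w^(jm) x_j^(-m); a cyclic shift of the x_j multiplies this sum by
   a k-th root of unity, so its k-th power is a cyclically invariant function of
   the roots, which becomes homogeneous of degree 0 on multiplying it by g^m,
   respectively b^m. *)
Require Import Defs.
From mathcomp Require Import all_boot all_order all_fingroup all_algebra cyclic separable cyclotomic.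
From mathcomp Require Import all_classical all_reals all_analysis.
From mathcomp Require Import complex ring zify.
From mathcomp Require Import -(notations) mpoly.
Set Implicit Arguments.
Unset Strict Implicit.
Unset Printing Implicit Defensive.
Import Order.TTheory GRing.Theory Num.Theory numFieldNormedType.Exports.
Local Open Scope classical_set_scope.
Local Open Scope ring_scope.

(** * Completeness of the complex numbers *)

(** The only form of completeness used below. It lets the analysis take place over an abstract
    [numClosedFieldType], whose norm has values in the field itself. *)
Definition geometric_complete (C : numClosedFieldType) :=
  forall u : nat -> C, (forall k, `|u k| <= 2^-1 ^+ k) -> cvgn (series u).

(** Real and imaginary parts are bounded by the modulus, so both real series converge by comparison
    with the geometric series of ratio 1/2. *)
Lemma geometric_complete_Cplx (R : realType) : geometric_complete (Cplx R).
Proof.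
move=> u hu.
have cvgR (a : nat -> R) : (forall k, `|a k| <= 2^-1 ^+ k) -> cvgn (series a).
  move=> ha; apply: normed_cvg.
  apply: (@series_le_cvg _ _ (geometric 1 2^-1)) => [k|k|k|].
  - exact: normr_ge0.
  - by apply: geometric_ge0.
  - by rewrite /= mul1r.
  - by apply: is_cvg_geometric_series; rewrite ger0_norm ?invf_lt1 // ltr1n.
have pow2 k : (2^-1 ^+ k : Cplx R) = ((2^-1 ^+ k : R)%:C)%C.
  by rewrite rmorphXn /= fmorphV rmorph_nat.
have sq (x : R) : Num.sqrt (x ^+ 2) = `|x| by exact: sqrtr_sqr.
have hRe k : `|complex.Re (u k)| <= 2^-1 ^+ k.
  have := hu k; rewrite pow2 normc_def lecR => h. apply: le_trans h.
  by rewrite -sq ler_wsqrtr // lerDl sqr_ge0.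
have hIm k : `|complex.Im (u k)| <= 2^-1 ^+ k.
  have := hu k; rewrite pow2 normc_def lecR => h; apply: le_trans h.
  by rewrite -sq ler_wsqrtr // lerDr sqr_ge0.
have cA := cvgR _ hRe; have cB := cvgR _ hIm.
set A := limn (series _) in cA; set B := limn (series _) in cB.
apply/cvg_ex; exists ((A +i* B)%C : Cplx R).
apply/cvgrPdist_lt => -[e e'] he.
(* A positive element of [R[i]] has zero imaginary part. *)
have /andP[/eqP e'0 e0] : (e' == 0) && (0 < e) by move: he; rewrite ltcE.
rewrite e'0 in he *.
have e2 : 0 < e / 2 by rewrite divr_gt0.
move/cvgrPdist_lt/(_ _ e2): cA => hA; move/cvgrPdist_lt/(_ _ e2): cB => hB.
near=> N.
have -> : (A +i* B)%C - series u N =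
    ((A - series (fun k => complex.Re (u k)) N)%:C)%C +
    'i%C * ((B - series (fun k => complex.Im (u k)) N)%:C)%C.
  have h1 : series u N = ((series (fun k => complex.Re (u k)) N)%:C)%C +
      'i%C * ((series (fun k => complex.Im (u k)) N)%:C)%C.
    rewrite !seriesEnat /= !rmorph_sum /= mulr_sumr -big_split /=.
    by apply: eq_bigr => i _; exact: complexE.
  by rewrite h1 [(A +i* B)%C]complexE /= !rmorphB /= mulrBr opprD addrACA.
apply: le_lt_trans (ler_normD _ _) _.
rewrite normrM !normc_def /= !expr0n /= !addr0 expr1n add0r sqrtr1 mul1r !sq.
rewrite -rmorphD /= (ltcR (_ + _) e) [ltRHS]splitr ltrD //.
  by near: N.
by near: N.
Unshelve. all: by end_near. Qed.

(** * Geometrically dominated series *)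

Section Series.
Variable C : numClosedFieldType.
Hypothesis hC : geometric_complete C.
Implicit Types u v w : nat -> C.

Lemma cvg_half : (2^-1 ^+ k : C) @[k --> \oo] --> (0 : C).
Proof.
apply: cvg_series_cvg_0; apply: hC => k.
by rewrite ger0_norm // exprn_ge0 // invr_ge0.
Qed.

Lemma cvgn_dist_le u l c e : u k @[k --> \oo] --> l ->
  (\forall k \near \oo, `|u k - c| <= e) -> `|l - c| <= e.
Proof.
move=> /cvgrPdist_lt cu hu; apply/ler_addgt0Pr => d d0.
near \oo => k.
have -> : l - c = (u k - c) + (l - u k) by ring.
apply: le_trans (ler_normD _ _) _; apply: lerD; first by near: k.
by apply: ltW; near: k; exact: cu.
Unshelve. all: by end_near. Qed.

(** The ratio 1/4, against 1/2 in [geometric_complete], leaves a factor 2^N that absorbs the N error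
    terms of a Cauchy product. *)
Definition tame u := forall k, `|u k| <= 4^-1 ^+ k.

Lemma quarter_le_half k : 4^-1 ^+ k <= 2^-1 ^+ k :> C.
Proof.
by apply: lerXn2r; rewrite ?nnegrE ?invr_ge0 // lef_pV2 ?posrE // ler_nat.
Qed.

Lemma tame_cvg u : tame u -> cvgn (series u).
Proof. by move=> hu; apply: hC => k; apply: le_trans (quarter_le_half k). Qed.

Lemma sum_quarter m n :
  \sum_(m <= k < n) 4^-1 ^+ k <= 2 * 4^-1 ^+ m :> C.
Proof.
have [mn|/ltnW nm] := leqP m n; last first.
  by rewrite big_geq // mulr_ge0 // exprn_ge0 // invr_ge0.
suff -> : \sum_(m <= k < n) 4^-1 ^+ k = 4 / 3 * (4^-1 ^+ m - 4^-1 ^+ n) :> C.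
  have h : 0 <= 4^-1 ^+ n :> C by rewrite exprn_ge0 // invr_ge0.
  have h' : 0 <= 4^-1 ^+ m :> C by rewrite exprn_ge0 // invr_ge0.
  rewrite -subr_ge0.
  have -> : 2 * 4^-1 ^+ m - 4 / 3 * (4^-1 ^+ m - 4^-1 ^+ n) =
     2 / 3 * 4^-1 ^+ m + 4 / 3 * 4^-1 ^+ n :> C by field.
  by rewrite addr_ge0 // mulr_ge0 // divr_ge0.
elim: n mn => [|n IH] mn.
  by move: mn; rewrite leqn0 => /eqP ->; rewrite big_geq // subrr mulr0.
move: mn; rewrite leq_eqVlt => /predU1P[->|mn].
  by rewrite big_geq // subrr mulr0.
by rewrite big_nat_recr //= IH // exprS; field.
Qed.

Lemma tame_dist u c e : u 0 = c -> 0 <= e ->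
  (forall k, `|u k.+1| <= e * 4^-1 ^+ k.+1) -> cvgn (series u) ->
  `|limn (series u) - c| <= e.
Proof.
move=> u0 e0 hu cu; apply: (cvgn_dist_le cu); exists 1%N => // -[//|N] _.
rewrite big_nat_recl //= u0 addrAC subrr add0r.
apply: le_trans (ler_norm_sum _ _ _) _.
apply: (@le_trans _ _ (\sum_(0 <= k < N) e * 4^-1 ^+ k.+1)).
  by apply: ler_sum => k _.
under eq_bigr do rewrite exprS mulrCA mulrC.
rewrite -mulr_suml.
have h := sum_quarter 0 N; rewrite expr0 mulr1 in h.
rewrite -mulr_sumr mulrC [leRHS](_ : e = 4^-1 * (e * 4)); last by field.
rewrite ler_wpM2l ?invr_ge0 // ler_wpM2l //; apply: le_trans h _.
by rewrite ler_nat.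
Qed.

Definition convol u v k := \sum_(i < k.+1) u i * v (k - i)%N.

Lemma series_convol u v N :
  series (convol u v) N = \sum_(i < N) u i * series v (N - i)%N.
Proof.
elim: N => [|N IH]; first by rewrite seriesEnat /= big_ord0 big_geq.
rewrite seriesSr IH [RHS]big_ord_recr /= subSnn.
rewrite /convol big_ord_recr /= subnn addrA -big_split /=.
congr (_ + _); last by rewrite seriesSr seriesEnat /= big_geq // add0r.
apply: eq_bigr => i _; rewrite subSn ?(ltnW (ltn_ord i)) //.
by rewrite seriesSr mulrDr.
Qed.

(** The product of the partial sums differs from the partial sum of the convolution by the terms u_i
    v_j with i + j >= N. For each i < N these total at most 2 * 4^-N, and N * 4^-N <= 2^-N. *)
Lemma tame_mul u v : tame u -> tame v ->
  series (convol u v) k @[k --> \oo] --> limn (series u) * limn (series v).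
Proof.
move=> hu hv.
have cuv : (series u \* series v) k @[k --> \oo] --> limn (series u) * limn (series v).
  by apply: cvgM; exact: tame_cvg.
rewrite -[X in _ --> X]subr0.
have -> : series (convol u v) =
   (series u \* series v) - (fun N => \sum_(i < N) u i * \sum_(N - i <= j < N) v j).
  apply/funext => N /=; rewrite !fctE series_convol.
  rewrite [X in _ = X - _](_ : _ = (\sum_(i < N) u i) * series v N); last first.
    by rewrite /= {1}seriesEord.
  rewrite mulr_suml -sumrB; apply: eq_bigr => i _.
  rewrite -mulrBr; congr (_ * _); apply/eqP; rewrite eq_sym subr_eq addrC seriesEnat /=; apply/eqP.
  by rewrite addrC -(big_cat_nat (n := (N - i)%N)) ?leq_subr.
apply: cvgB => //.
have h2 : (2 * 2^-1 ^+ k : C) @[k --> \oo] --> (0 : C).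
  by rewrite -[X in _ --> X](mulr0 2); apply: cvgM; [exact: cvg_cst|exact: cvg_half].
apply/cvgrPdist_lt => e e0; have /cvgr0Pnorm_lt/(_ _ e0) h3 := h2.
near=> N; rewrite sub0r normrN; apply: le_lt_trans (_ : _ <= `|2 * 2^-1 ^+ N|) _; last first.
  by near: N; exact: h3.
rewrite [leRHS]ger0_norm ?mulr_ge0 ?exprn_ge0 ?invr_ge0 //.
apply: le_trans (ler_norm_sum _ _ _) _.
apply: (@le_trans _ _ (\sum_(i < N) 2 * 4^-1 ^+ N)).
  apply: ler_sum => i _; rewrite normrM.
  have -> : 2 * 4^-1 ^+ N = 4^-1 ^+ i * (2 * 4^-1 ^+ (N - i)) :> C.
    by rewrite mulrCA -exprD subnKC // ltnW.
  apply: ler_pM => //; apply: le_trans (ler_norm_sum _ _ _) _.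
  by apply: le_trans (sum_quarter _ _); apply: ler_sum => k _.
rewrite sumr_const card_ord -[_ *+ N]mulr_natl mulrCA ler_wpM2l //.
have -> : 2^-1 ^+ N = 2 ^+ N * 4^-1 ^+ N :> C.
  by rewrite -exprMn; congr (_ ^+ _); field.
rewrite ler_wpM2r ?exprn_ge0 ?invr_ge0 // -natrX ler_nat ltnW //.
exact: ltn_expl.
Unshelve. all: by end_near. Qed.

Lemma limn_series_subseq u m : (0 < m)%N -> cvgn (series u) ->
  (forall k, ~~ (m %| k)%N -> u k = 0) ->
  series (fun k => u (m * k)%N) k @[k --> \oo] --> limn (series u).
Proof.
move=> m0 cu hu.
have -> : series (fun k => u (m * k)%N) = (series u) \o muln m.
  apply/funext; elim=> [|N IH]; rewrite /= ?muln0; first by rewrite !seriesEnat /= !big_geq.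
  rewrite seriesSr IH /= mulnS series_addn; congr (_ + _).
  rewrite big_ltn; last by rewrite -[X in (X < _)%N]add0n ltn_add2r.
  rewrite big_nat_cond big1 ?addr0 // => i /andP[/andP[h1 h2] _]; apply: hu.
  apply/negP => /dvdnP[j ej]; move: h1 h2; rewrite ej -mulnS.
  by rewrite (mulnC j) !ltn_pmul2l // ltnS => /leq_trans h /h; rewrite ltnn.
apply: cvg_comp cu => A [N _ hN]; exists N => // k /= hk; apply: hN.
exact: leq_trans hk (leq_pmull k m0).
Qed.

End Series.

(** A substitute for Stirling's formula: n^n is at most the falling factorial (2n)(2n-1)...(n+1),
    which is n! times the central binomial coefficient, and the latter is at most 4^n. *)
Lemma expn_self_le n : (n ^ n <= 4 ^ n * n`!)%N.
Proof.
have h : (n ^ n <= (n + n) ^_ n)%N.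
  rewrite ffact_prod -[X in (_ ^ X <= _)%N]card_ord -prod_nat_const.
  by apply: leq_prod => i _; rewrite -addnBA ?leq_addr // ltnW.
apply: leq_trans h _; rewrite -bin_ffact leq_mul2r; apply/orP; right.
rewrite (_ : 4 = 2 * 2)%N // expnMn -expnD.
have -> : (2 ^ (n + n) = \sum_(i < (n + n).+1) 'C(n + n, i))%N.
  by rewrite (_ : 2 = 1 + 1)%N // Pascal; apply: eq_bigr => i _; rewrite !exp1n !muln1.
have hn : (n < (n + n).+1)%N by rewrite ltnS leq_addr.
by rewrite (bigD1 (Ordinal hn)) //= leq_addr.
Qed.

(** * The generalized binomial series *)

Section Fuss.
Variable C : numClosedFieldType.
Variable tau : C.
Implicit Types r s t B : C.

(** The Fuss-Catalan coefficient r / (r + k tau) times the binomial of r + k tau over k. Cancelling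
    r + k tau makes it a polynomial in r. *)
Definition fuss r k : C :=
  if k is k'.+1
  then r * (\prod_(i < k') (r + k%:R * tau - i.+1%:R)) / k`!%:R else 1.

Let fussp k : {poly C} :=
  if k is k'.+1
  then (k`!%:R)^-1 *: ('X * \prod_(i < k') ('X + (k%:R * tau - i.+1%:R)%:P))
  else 1.

Let horner_fussp k r : (fussp k).[r] = fuss r k.
Proof.
case: k => [|k]; rewrite /fussp /fuss; first by rewrite hornerE.
rewrite hornerZ hornerM hornerX horner_prod mulrC.
by congr (_ * _ / _); apply: eq_bigr => i _; rewrite hornerD hornerX hornerC addrA.
Qed.

Lemma fact_neq0 k : k`!%:R != 0 :> C.
Proof. by rewrite pnatr_eq0 -lt0n fact_gt0. Qed.

Lemma fuss0 k : fuss 0 k = (k == 0)%:R.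
Proof. by case: k => //= k; rewrite !mul0r. Qed.

(** Coefficient form of A_r = A_(r-1) + t A_(r-1+tau), as A_1 = 1 + t A_tau and multiplicativity
    would predict. From index 2 on, the three coefficients share the k factors [Q], and an
    elementary identity remains. *)
Lemma fuss_rec r k : fuss r k.+1 = fuss (r - 1) k.+1 + fuss (r - 1 + tau) k.
Proof.
case: k => [|k].
  by rewrite /fuss !big_ord0 (factS 0) fact0 muln1 !divr1 !mulr1; ring.
rewrite /fuss big_ord_recl [X in _ = X + _]/= big_ord_recr /=.
set Q := \prod_(i < k) (r + k.+2%:R * tau - (bump 0 i).+1%:R).
have -> : \prod_(i < k) (r - 1 + k.+2%:R * tau - i.+1%:R) = Q.
  by apply: eq_bigr => i _; rewrite /bump /= add1n -[i.+2]addn1 natrD; ring.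
have -> : \prod_(i < k) (r - 1 + tau + k.+1%:R * tau - i.+1%:R) = Q.
  apply: eq_bigr => i _; rewrite /bump /= add1n -[i.+2]addn1 natrD.
  by rewrite -[k.+2]addn1 natrD; ring.
rewrite [k.+2`!]factS natrM.
have h1 : k.+2%:R != 0 :> C by rewrite pnatr_eq0.
have h2 := fact_neq0 k.+1.
have e1 : k.+1%:R = k%:R + 1 :> C by rewrite -natr1.
have e2 : k.+2%:R = k%:R + 2 :> C by rewrite -[k.+2]addn2 natrD.
move: h1 h2; rewrite {}e2 {}e1; set F := (k.+1)`!%:R => h1 h2.
by field; rewrite h2.
Qed.

Lemma poly_nat_root0 (P : {poly C}) : (forall n : nat, P.[n%:R] = 0) -> P = 0.
Proof.
move=> h; apply: (@roots_geq_poly_eq0 _ _ [seq i%:R | i <- iota 0 (size P)]).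
- by apply/allP => _ /mapP[i _ ->]; apply/rootP.
- by rewrite map_inj_uniq ?iota_uniq // => i j /eqP; rewrite eqr_nat => /eqP.
- by rewrite size_map size_iota.
Qed.

(* The Rothe-Hagen identity.  For fixed s the difference D of the two sides is a
   polynomial in r; by fuss_rec and induction it vanishes at every natural r. *)
Lemma convol_fuss r s k : convol (fuss r) (fuss s) k = fuss (r + s) k.
Proof.
elim: k r s => [|k IH] r s; first by rewrite /convol big_ord1 /= mulr1.
pose D := \sum_(i < k.+2) fuss s (k.+1 - i)%N *: fussp i - (fussp k.+1 \Po ('X + s%:P)).
have hD x : D.[x] = convol (fuss x) (fuss s) k.+1 - fuss (x + s) k.+1.
  rewrite /D hornerD hornerN horner_comp hornerD hornerX hornerC horner_sum horner_fussp.
  by congr (_ - _); apply: eq_bigr => i _; rewrite hornerZ horner_fussp mulrC.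
suff D0 : D = 0 by apply/eqP; rewrite -subr_eq0 -hD D0 horner0.
apply: poly_nat_root0; elim=> [|n]; rewrite !hD.
  rewrite add0r /convol big_ord_recl fuss0 mul1r subn0 big1 ?addr0 ?subrr // => i _.
  by rewrite fuss0 mul0r.
move/eqP; rewrite subr_eq0 => /eqP IHn; apply/eqP; rewrite subr_eq0; apply/eqP.
rewrite [RHS]fuss_rec.
have -> : n.+1%:R + s - 1 = n%:R + s by rewrite -natr1; ring.
have -> : n%:R + s + tau = n%:R + tau + s by ring.
rewrite -IHn -IH /convol big_ord_recl [in RHS]big_ord_recl -addrA -big_split.
congr (_ + _); apply: eq_bigr => i _; rewrite lift0.
by rewrite fuss_rec subSS -natr1 addrK mulrDl.
Qed.

(** At r = 1 the first factor of the product is the index times [tau], and the index cancels against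
    the factorial. This yields A_1 = 1 + t A_tau. *)
Lemma fuss1 k : fuss 1 k.+1 = fuss tau k.
Proof.
case: k => [|k]; first by rewrite /fuss big_ord0 (factS 0) fact0 muln1 divr1 !mulr1.
rewrite /fuss factS natrM big_ord_recl /= mul1r.
have -> : 1 + k.+2%:R * tau - 1%:R = k.+2%:R * tau by rewrite addrAC subrr add0r.
have -> : \prod_(i < k) (1 + k.+2%:R * tau - (bump 0 i).+1%:R) =
   \prod_(i < k) (tau + k.+1%:R * tau - i.+1%:R).
  apply: eq_bigr => i _; rewrite /bump /= add1n -[i.+2]addn1 natrD.
  by rewrite -[k.+2]addn1 natrD; ring.
by field; rewrite fact_neq0 -natrD pnatr_eq0.
Qed.

(** Each of the k factors is at most (k+1) B in norm, and [expn_self_le] bounds (k+1)^(k+1) / (k+1)!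
    by 4^(k+1). *)
Lemma fuss_bound r B k : `|r| + `|tau| + 1 <= B ->
  `|fuss r k.+1| <= `|r| * (4 * B) ^+ k.+1.
Proof.
move=> hB.
have B1 : 1 <= B by apply: le_trans hB; rewrite lerDr addr_ge0.
have B0 : 0 <= B := le_trans ler01 B1.
rewrite /fuss !normrM -mulrA ler_wpM2l // normfV normr_nat.
have f0 : 0 < (k.+1`!)%:R :> C by rewrite ltr0n fact_gt0.
rewrite ler_pdivrMr //.
apply: (@le_trans _ _ ((k.+1%:R * B) ^+ k)).
  rewrite normr_prod -[X in _ <= _ ^+ X]card_ord -prodr_const.
  apply: ler_prod => i _; rewrite normr_ge0 /=.
  apply: le_trans (ler_normB _ _) _; rewrite normr_nat.
  apply: (@le_trans _ _ (`|r| + k.+1%:R * `|tau| + k.+1%:R)).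
    apply: lerD; last by rewrite ler_nat ltnS ltnW.
    by apply: le_trans (ler_normD _ _) _; rewrite normrM normr_nat.
  apply: (@le_trans _ _ (k.+1%:R * (`|r| + `|tau| + 1))); last first.
    by rewrite ler_wpM2l.
  by rewrite !mulrDr mulr1 !lerD2r ler_peMl // ler1n.
rewrite !exprMn.
apply: (@le_trans _ _ (k.+1%:R ^+ k.+1 * B ^+ k.+1)).
  apply: ler_pM; rewrite ?exprn_ge0 //.
    by rewrite exprS ler_peMl ?exprn_ge0 // ler1n.
  by rewrite exprS ler_peMl // exprn_ge0.
rewrite mulrAC ler_wpM2r ?exprn_ge0 // -!natrX -natrM ler_nat.
exact: expn_self_le.
Qed.

Definition fuss_term r t k := fuss r k * t ^+ k.
Definition fuss_fun r t : C := limn (series (fuss_term r t)).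

(** Since B >= 1, the smallness of t gives 4 B |t| <= 1/4. One factor 4 B |t| is kept and the others
    are replaced by 1/4, so the bound still tends to 0 with r or with t. *)
Lemma fuss_term_bound r B t k : `|r| + `|tau| + 1 <= B -> 16 * B ^+ 2 * `|t| <= 1 ->
  `|fuss_term r t k.+1| <= (16 * B * `|r| * `|t|) * 4^-1 ^+ k.+1.
Proof.
move=> hB ht.
have B1 : 1 <= B by apply: le_trans hB; rewrite lerDr addr_ge0.
have B0 : 0 <= B := le_trans ler01 B1.
rewrite /fuss_term normrM normrX.
apply: (@le_trans _ _ (`|r| * (4 * B * `|t|) ^+ k.+1)).
  by rewrite (exprMn k.+1 (4 * B)) mulrA ler_wpM2r ?exprn_ge0 // fuss_bound.
have -> : 16 * B * `|r| * `|t| * 4^-1 ^+ k.+1 =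
  `|r| * ((4 * B * `|t|) * 4^-1 ^+ k) :> C by rewrite exprS; field.
rewrite ler_wpM2l // exprS ler_wpM2l ?mulr_ge0 //.
apply: lerXn2r; rewrite ?nnegrE ?mulr_ge0 ?invr_ge0 //.
rewrite -[leRHS]mul1r ler_pdivlMr ?ltr0n //; apply: le_trans ht.
have -> : 4 * B * `|t| * 4 = 16 * B * `|t| by ring.
by rewrite ler_wpM2r // ler_wpM2l // expr2 ler_peMl.
Qed.

Lemma tame_fuss r B t : `|r| + `|tau| + 1 <= B -> 16 * B ^+ 2 * `|t| <= 1 ->
  tame (fuss_term r t).
Proof.
move=> hB ht [|k]; first by rewrite /fuss_term /= !mulr1 normr1.
apply: le_trans (fuss_term_bound _ hB ht) _.
rewrite -[leRHS]mul1r ler_wpM2r ?exprn_ge0 ?invr_ge0 //.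
have rB : `|r| <= B by apply: le_trans hB; rewrite -addrA lerDl addr_ge0.
have B0 : 0 <= B := le_trans (normr_ge0 _) rB.
apply: le_trans ht; rewrite ler_wpM2r // expr2 mulrA ler_wpM2l //.
by rewrite mulr_ge0.
Qed.

Hypothesis hC : geometric_complete C.
Let chaus : hausdorff_space C := @norm_hausdorff C C.

Lemma fuss_fun_dist r B t : `|r| + `|tau| + 1 <= B -> 16 * B ^+ 2 * `|t| <= 1 ->
  `|fuss_fun r t - 1| <= 16 * B * `|r| * `|t|.
Proof.
move=> hB ht.
have B0 : 0 <= B by apply: le_trans hB; rewrite !addr_ge0.
apply: tame_dist => //.
- by rewrite /fuss_term mulr1.
- by rewrite !mulr_ge0.
- by move=> k; apply: fuss_term_bound.
- by apply: tame_cvg => //; apply: tame_fuss ht.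
Qed.

Lemma fuss_funD r s B t : `|r| + `|tau| + 1 <= B -> `|s| + `|tau| + 1 <= B ->
  16 * B ^+ 2 * `|t| <= 1 -> fuss_fun (r + s) t = fuss_fun r t * fuss_fun s t.
Proof.
move=> hr hs ht.
rewrite -[RHS](cvg_lim chaus (tame_mul hC (tame_fuss hr ht) (tame_fuss hs ht))).
congr (limn (series _)); apply/funext => k; rewrite /fuss_term -convol_fuss.
rewrite /convol mulr_suml; apply: eq_bigr => i _.
by rewrite mulrACA -exprD subnKC // -ltnS.
Qed.

Lemma fuss_fun0 t : fuss_fun 0 t = 1.
Proof.
apply: (cvg_lim chaus); apply/cvgrPdist_lt => e e0; exists 1%N => // -[//|N] _ /=.
rewrite seriesEnat /= big_nat_recl //= big1 ?addr0; last first.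
  by move=> i _; rewrite /fuss_term fuss0 mul0r.
by rewrite /fuss_term mulr1 subrr normr0.
Qed.

Lemma fuss_fun1 B t : 1 + `|tau| + 1 <= B -> `|tau| + `|tau| + 1 <= B ->
  16 * B ^+ 2 * `|t| <= 1 -> fuss_fun 1 t = 1 + t * fuss_fun tau t.
Proof.
move=> h1 ht hB.
have ct := tame_cvg hC (tame_fuss ht hB).
apply: (cvg_lim chaus); rewrite -cvg_shiftS.
rewrite (_ : (fun n => _) = (fun N => 1 + t * series (fuss_term tau t) N)); last first.
  apply/funext => N; rewrite !seriesEnat /= big_nat_recl //= mulr_sumr.
  congr (_ + _); first by rewrite /fuss_term mulr1.
  by apply: eq_bigr => i _; rewrite /fuss_term fuss1 exprS mulrCA.
by apply: cvgD; [exact: cvg_cst|apply: cvgM; [exact: cvg_cst|exact: ct]].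
Qed.

Lemma cvgMl_cst T (F : set_system T) (FF : Filter F) (f : T -> C) (c l : C) :
  f x @[x --> F] --> l -> (c * f x) @[x --> F] --> c * l.
Proof. by move=> cf; apply: (cvgM (cvg_cst c) cf). Qed.

Lemma cvg_subr_self (a : C) : (b - a) @[b --> a] --> (0 : C).
Proof.
rewrite -(subrr a).
exact: (@cvgB C C C (nbhs a) _ id (fun=> a) a a cvg_id (cvg_cst _)).
Qed.

Lemma near0_small B : 1 <= B -> \forall t \near (0 : C), 16 * B ^+ 2 * `|t| <= 1.
Proof.
move=> B1; have B0 : 0 < 16 * B ^+ 2.
  by rewrite mulr_gt0 // exprn_gt0 // (lt_le_trans ltr01).
near=> t; rewrite mulrC -ler_pdivlMr // mul1r.
by near: t; apply: (@nbhs0_le C C); rewrite invr_gt0.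
Unshelve. all: by end_near. Qed.

Lemma fuss_fun_cvg r : fuss_fun r t @[t --> (0 : C)] --> (1 : C).
Proof.
pose B := `|r| + `|tau| + 1.
have B1 : 1 <= B by rewrite lerDr addr_ge0.
have h0 : (16 * B * `|r| * t : C) @[t --> (0 : C)] --> (0 : C).
  by rewrite -[X in _ --> X](mulr0 (16 * B * `|r|)); exact: (@cvgMl_cst _ (nbhs (0 : C)) _ id).
apply/(@cvgrPdist_lt C C _ (nbhs (0 : C))) => e e0; have /(@cvgr0Pnorm_lt C C _ (nbhs (0 : C)))/(_ _ e0) h := h0.
near=> t; rewrite distrC.
apply: le_lt_trans (_ : `|16 * B * `|r| * t| < _); last by near: t.
rewrite normrM [X in X * _]ger0_norm ?mulr_ge0 ?(le_trans ler01 B1) //.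
by apply: fuss_fun_dist => //; near: t; exact: near0_small.
Unshelve. all: by end_near. Qed.

(** A_b = A_a A_(b-a), and A_(b-a) tends to 1 by [fuss_fun_dist], whose bound is proportional to
    |r|. The constant 2 instead of 1 makes room for |b - a| <= 1. *)
Lemma fuss_fun_cvg_param a B t : `|a| + `|tau| + 2 <= B -> 16 * B ^+ 2 * `|t| <= 1 ->
  fuss_fun b t @[b --> a] --> fuss_fun a t.
Proof.
move=> hB ht.
have B0 : 0 <= B by apply: le_trans hB; rewrite !addr_ge0.
have ha : `|a| + `|tau| + 1 <= B by apply: le_trans hB; rewrite lerD2l ler1n.
have hb : \forall b \near a, `|b - a| + `|tau| + 1 <= B.
  have /(@cvgr0Pnorm_lt C C _ (nbhs a))/(_ _ (@ltr01 C)) := @cvg_subr_self a.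
  apply: filterS => b /ltW b1; apply: le_trans hB.
  apply: (@le_trans _ _ (`|tau| + 2)); last by rewrite lerD2r lerDr.
  by have -> : `|tau| + 2 = 1 + `|tau| + 1; [ring|rewrite !lerD2r].
have h1 : fuss_fun (b - a) t @[b --> a] --> (1 : C).
  have h0 : (16 * B * (b - a) * `|t| : C) @[b --> a] --> (0 : C).
    rewrite -(mulr0 (16 * B * `|t|)); under eq_fun do rewrite mulrAC.
    apply: (@cvgMl_cst _ (nbhs a)).
    exact: cvg_subr_self.
  apply/(@cvgrPdist_lt C C _ (nbhs a)) => e e0; have /(@cvgr0Pnorm_lt C C _ (nbhs a))/(_ _ e0) h := h0.
  near=> b; rewrite distrC.
  apply: le_lt_trans (_ : `|16 * B * (b - a) * `|t| | < _); last by near: b.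
  rewrite 2!normrM normr_id [X in X * _ * _]ger0_norm ?mulr_ge0 //.
  by apply: fuss_fun_dist => //; near: b.
rewrite -[X in _ --> X]mulr1.
apply: (@cvg_trans _ (fuss_fun a t * fuss_fun (b - a) t @[b --> a])); last first.
  by apply: (@cvgMl_cst _ (nbhs a)); exact: h1.
apply: (@near_eq_cvg _ _ (nbhs a)); near=> b.
rewrite -(@fuss_funD _ _ B) ?subrKC //; near: b; exact: hb.
Unshelve. all: by end_near. Qed.

Lemma fuss_funN r B t : `|r| + `|tau| + 1 <= B -> 16 * B ^+ 2 * `|t| <= 1 ->
  fuss_fun (- r) t = (fuss_fun r t)^-1.
Proof.
move=> hB ht.
have h : fuss_fun r t * fuss_fun (- r) t = 1.
  by rewrite -(@fuss_funD _ _ B) ?normrN // subrr fuss_fun0.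
have r0 : fuss_fun r t != 0.
  by apply/eqP => r0; move/eqP: h; rewrite r0 mul0r eq_sym oner_eq0.
by apply: (mulfI r0); rewrite h divff.
Qed.

Lemma fuss_funMn r B t j : `|r *+ j| + `|tau| + 1 <= B -> 16 * B ^+ 2 * `|t| <= 1 ->
  fuss_fun (r *+ j) t = fuss_fun r t ^+ j.
Proof.
elim: j => [|j IH] hB ht; first by rewrite fuss_fun0.
have h i : (i <= j.+1)%N -> `|r *+ i| + `|tau| + 1 <= B.
  move=> ij; apply: le_trans hB; rewrite !lerD2r !normrMn.
  by rewrite ler_wpMn2l.
rewrite mulrS exprS (@fuss_funD _ _ B) // ?IH //; first exact: h.
- exact: (h 1).
- exact: h.
Qed.

Lemma fuss_funMz r B t (m : int) : `|r *~ m| + `|tau| + 1 <= B ->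
  16 * B ^+ 2 * `|t| <= 1 -> fuss_fun (r *~ m) t = fuss_fun r t ^ m.
Proof.
case: m => j hB ht; first exact: fuss_funMn hB ht.
move: hB; rewrite NegzE mulrNz normrN => hB.
by rewrite (fuss_funN hB) // (fuss_funMn hB).
Qed.

End Fuss.

(** * Hypergeometric functions as averages *)

Section HypergeomFuss.
Variable C : numClosedFieldType.
Hypothesis hC : geometric_complete C.
Implicit Types a b r t w : C.

Let chaus : hausdorff_space C := @norm_hausdorff C C.

Lemma sum_prim_root_exp k w i : k.-primitive_root w ->
  \sum_(j < k) (w ^+ j) ^+ i = (if (k %| i)%N then k%:R else 0).
Proof.
move=> hw; under eq_bigr do rewrite exprAC.
case: ifP => [/dvdnP[d ->]|ki].
  rewrite mulnC exprM (prim_expr_order hw) expr1n.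
  by under eq_bigr do rewrite expr1n; rewrite sumr_const card_ord.
have wi : 1 - w ^+ i != 0.
  by rewrite subr_eq0 eq_sym -(prim_order_dvd hw) ki.
apply: (mulfI wi); rewrite mulr0.
have := subrXX 1 (w ^+ i) k; rewrite expr1n exprAC (prim_expr_order hw) expr1n subrr => h; rewrite [RHS]h.
by congr (_ * _); apply: eq_bigr => j _; rewrite expr1n mul1r.
Qed.

Lemma norm_prim_root_mul k w j t : k.-primitive_root w -> `|w ^+ j * t| = `|t|.
Proof.
move=> hw; rewrite normrM normrX; suff -> : `|w| = 1 by rewrite expr1n mul1r.
apply: (@pexpIrn _ k); rewrite ?nnegrE ?(prim_order_gt0 hw) //.
by rewrite -normrX (prim_expr_order hw) normr1 expr1n.
Qed.

(** A root-of-unity filter: summing the series over the points w^j t multiplies the coefficients at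
    multiples of k by k and kills the others. *)
Lemma series_fuss_average tau k w r B t : k.-primitive_root w ->
  `|r| + `|tau| + 1 <= B -> 16 * B ^+ 2 * `|t| <= 1 ->
  series (fun K => k%:R * fuss_term tau r t (k * K)) K @[K --> \oo] -->
    \sum_(j < k) fuss_fun tau r (w ^+ j * t).
Proof.
move=> hw hB ht; have k0 := prim_order_gt0 hw.
have w1 j := norm_prim_root_mul j t hw.
have ctj (j : 'I_k) : series (fuss_term tau r (w ^+ j * t)) K @[K --> \oo] -->
    fuss_fun tau r (w ^+ j * t).
  by apply: tame_cvg => //; apply: tame_fuss hB _; rewrite w1.
pose v i := \sum_(j < k) fuss_term tau r (w ^+ j * t) i.
have vE i : v i = (if (k %| i)%N then k%:R else 0) * fuss_term tau r t i.
  rewrite -(sum_prim_root_exp _ hw) mulr_suml; apply: eq_bigr => j _.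
  by rewrite /fuss_term exprMn mulrCA.
have cv : series v K @[K --> \oo] --> \sum_(j < k) fuss_fun tau r (w ^+ j * t).
  rewrite (_ : series v = fun K => \sum_(j < k) series (fuss_term tau r (w ^+ j * t)) K).
    by apply: cvg_big => [|j _]; [exact: add_continuous|exact: ctj].
  apply/funext => K; rewrite seriesEnat /= exchange_big /=.
  by apply: eq_bigr => j _; rewrite seriesEnat.
rewrite -(cvg_lim chaus cv).
rewrite [X in series X](_ : _ = (fun K => v (k * K)%N)); last first.
  by apply/funext => K; rewrite vE dvdn_mulr.
apply: limn_series_subseq => //; first by apply/cvg_ex; exists (\sum_(j < k) fuss_fun tau r (w ^+ j * t)).
by move=> i ki; rewrite vE (negbTE ki) mul0r.
Qed.

Lemma hypergeom_fuss us ls z tau k w r B t : k.-primitive_root w ->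
  `|r| + `|tau| + 1 <= B -> 16 * B ^+ 2 * `|t| <= 1 ->
  (forall K, hypergeom_coef us ls K * z ^+ K = fuss_term tau r t (k * K)) ->
  hypergeom us ls z = k%:R^-1 * \sum_(j < k) fuss_fun tau r (w ^+ j * t).
Proof.
move=> hw hB ht hc; have k0 := prim_order_gt0 hw.
have kn0 : k%:R != 0 :> C by rewrite pnatr_eq0 -lt0n.
have cs := series_fuss_average hw hB ht.
apply: (cvg_lim chaus).
rewrite (_ : series _ = fun K => k%:R^-1 * series (fun K => k%:R * fuss_term tau r t (k * K)) K).
  exact: cvgMl_cst.
apply/funext => K; rewrite !seriesEnat /= mulr_sumr; apply: eq_bigr => i _.
by rewrite hc mulKf.
Qed.

(** * Products of Pochhammer symbols *)

Lemma pochhammerD a m l :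
  pochhammer a (m + l) = pochhammer a m * pochhammer (a + m%:R) l.
Proof.
rewrite /pochhammer big_split_ord /=; congr (_ * _); apply: eq_bigr => i _.
by rewrite natrD addrA.
Qed.

Lemma pochhammerS a m : pochhammer a m.+1 = a * pochhammer (a + 1) m.
Proof. by rewrite -add1n pochhammerD /pochhammer big_ord1 addr0. Qed.

Lemma pochhammer1 k : pochhammer (1 : C) k = k`!%:R.
Proof.
elim: k => [|k IH]; first by rewrite /pochhammer big_ord0.
by rewrite -[in LHS]addn1 pochhammerD IH /pochhammer big_ord1 addr0 factS natrM mulrC nat1r.
Qed.

(** The multiplication formula of Gauss. Raising K by 1 appends to (a)_(nK) the n factors a + nK + i
    = n ((a + i)/n + K), one for each parameter. *)
Lemma prod_pochhammer a n K : (0 < n)%N ->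
  \prod_(i < n) pochhammer ((a + i%:R) / n%:R) K =
  pochhammer a (n * K) / n%:R ^+ (n * K).
Proof.
move=> n0; have nn0 : n%:R != 0 :> C by rewrite pnatr_eq0 -lt0n.
elim: K => [|K IH].
  rewrite muln0 expr0 divr1 /pochhammer big_ord0 big1 // => i _.
  by rewrite big_ord0.
rewrite mulnS addnC pochhammerD exprD invfM mulrACA -IH -exprVn.
rewrite -[X in _ = _ * (_ * _ ^+ X)](card_ord n) -prodr_const -big_split -big_split /=.
apply: eq_bigr => i _; rewrite -addn1 pochhammerD; congr (_ * _).
rewrite /pochhammer big_ord1 addr0 natrM.
by field.
Qed.

Lemma prod_pochhammer_seq a n K m : (0 < n)%N ->
  \prod_(u <- [seq (a + i%:R) / n%:R | i <- iota m n]) pochhammer u K =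
  pochhammer (a + m%:R) (n * K) / n%:R ^+ (n * K).
Proof.
move=> n0; rewrite -prod_pochhammer // big_map -[m in iota m n]addn0 iotaDl big_map.
rewrite -[n in iota 0 n]subn0 big_mkord; apply: eq_bigr => i _.
by rewrite natrD addrA.
Qed.

(** The factor K! supplies the Pochhammer symbol of the missing parameter n/n = 1. *)
Lemma prod_pochhammer_fact n K : (0 < n)%N ->
  (\prod_(u <- [seq i%:R / n%:R | i <- iota 1 n.-1]) pochhammer u K) * K`!%:R =
  (n * K)`!%:R / n%:R ^+ (n * K) :> C.
Proof.
move=> n0; have nn0 : n%:R != 0 :> C by rewrite pnatr_eq0 -lt0n.
have := @prod_pochhammer_seq 0 n K 1 n0; rewrite add0r pochhammer1 => <-.
have -> : iota 1 n = iota 1 n.-1 ++ [:: n].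
  by case: (n) n0 => // k _; rewrite -[X in iota 1 X]addn1 iotaD add1n.
rewrite !big_map big_cat big_seq1 /= add0r divff // pochhammer1.
by congr (_ * _); apply: eq_bigr => i _; rewrite add0r.
Qed.

Lemma prod_falling (r : C) P :
  \prod_(i < P) (r + P%:R - i.+1%:R) = pochhammer r P.
Proof.
rewrite (reindex_inj rev_ord_inj) /=; apply: eq_bigr => i _.
by rewrite subnSK // natrB ?(ltnW (ltn_ord i)) //; ring.
Qed.

(** Since (P + Q) tau = P, the product descends from r + P - 1 in steps of 1. Its first P factors
    form (r)_P; the remaining Q - 1, with the leading r, form (-1)^Q (-r)_Q. *)
Lemma fuss_pos tau (r : C) P Q : (0 < Q)%N -> (P + Q)%:R * tau = P%:R ->
  fuss tau r (P + Q) =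
  (-1) ^+ Q * pochhammer r P * pochhammer (- r) Q / (P + Q)`!%:R.
Proof.
case: Q => // Q _; rewrite addnS /fuss => ->; congr (_ / _).
rewrite big_split_ord /= prod_falling.
have -> : \prod_(i < Q) (r + P%:R - (P + i).+1%:R) = (-1) ^+ Q * pochhammer (- r + 1) Q.
  rewrite -[X in _ ^+ X](card_ord Q) -prodr_const -big_split /=.
  by apply: eq_bigr => i _; rewrite -natr1 natrD; ring.
by rewrite pochhammerS exprS; ring.
Qed.

(** Up to sign the factors are b and b + P + 1, b + P + 2, and so on; (b + 1)_P fills the gap. It
    stays on the left because it may vanish. *)
Lemma fuss_neg tau (b : C) P M : (0 < M)%N -> M%:R * tau = - P%:R ->
  fuss tau (- b) M * pochhammer (b + 1) P =
  (-1) ^+ M * pochhammer b (P + M) / M`!%:R.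
Proof.
case: M => // M _; rewrite addnS pochhammerS /fuss => ->.
rewrite pochhammerD.
have -> : \prod_(i < M) (- b - P%:R - i.+1%:R) = (-1) ^+ M * pochhammer (b + 1 + P%:R) M.
  rewrite -[X in _ ^+ X](card_ord M) -prodr_const -big_split /=.
  by apply: eq_bigr => i _; rewrite -natr1; ring.
by rewrite exprS; ring.
Qed.

Lemma pochhammer_neq0 a k : (forall i, (i < k)%N -> a + i%:R != 0) -> pochhammer a k != 0.
Proof. by move=> h; apply/prodf_neq0 => i _; exact: h. Qed.

(** * The coefficients of the two hypergeometric series *)

Variables p q : nat.
Hypotheses (p_gt0 : (0 < p)%N) (q_gt0 : (0 < q)%N).

Let n_gt0 : (0 < p + q)%N. Proof. by rewrite addn_gt0 p_gt0. Qed.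
Let p0 : p%:R != 0 :> C. Proof. by rewrite pnatr_eq0 -lt0n. Qed.
Let q0 : q%:R != 0 :> C. Proof. by rewrite pnatr_eq0 -lt0n. Qed.
Let n0 : (p + q)%:R != 0 :> C. Proof. by rewrite pnatr_eq0 -lt0n. Qed.

Lemma zeta_ofE (b g : C) : zeta_of p q b g =
  (-1) ^+ q * (p + q)%:R ^+ (p + q) / (p%:R ^+ p * q%:R ^+ q) * (b ^+ q / g ^+ (p + q)).
Proof. by rewrite /zeta_of natrM !natrX. Qed.

Lemma zeta_of11_neq0 : zeta_of p q 1 1 != 0 :> C.
Proof.
rewrite zeta_ofE !expr1n divr1 mulr1 !mulf_neq0 ?invr_eq0 ?signr_eq0 //.
  by rewrite expf_neq0.
by rewrite mulf_neq0 ?expf_neq0.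
Qed.

(** This is [fuss_pos] with P = pK and Q = qK; the powers of p, q and p + q from the multiplication
    formula cancel the constant in zeta. *)
Lemma Fn_coef a t K :
  hypergeom_coef (Fn_upper p q a) (Fn_lower C p q) K * (zeta_of p q 1 t)^-1 ^+ K =
  fuss_term (p%:R / (p + q)%:R) (- a) t ((p + q) * K).
Proof.
rewrite /hypergeom_coef /Fn_upper big_cat !prod_pochhammer_seq //= prod_pochhammer_fact //.
rewrite /fuss_term; have -> : fuss (p%:R / (p + q)%:R) (- a) ((p + q) * K) =
  (-1) ^+ (q * K) * pochhammer (- a) (p * K) * pochhammer a (q * K) / ((p + q) * K)`!%:R.
  case: K => [|K]; first by rewrite !muln0 /pochhammer !big_ord0 fact0 expr0 !mul1r invr1.
  rewrite mulnDl fuss_pos ?opprK ?muln_gt0 ?q_gt0 //.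
  by rewrite -mulnDl !natrM; field; rewrite -natrD.
rewrite !addr0 zeta_ofE expr1n mul1r !invfM !invrK invr_sign !exprMn !exprVn -!exprM.
have f0 := fact_neq0 C ((p + q) * K).
have pK : p%:R ^+ (p * K) != 0 :> C by rewrite expf_neq0.
have qK : q%:R ^+ (q * K) != 0 :> C by rewrite expf_neq0.
have nK : (p + q)%:R ^+ ((p + q) * K) != 0 :> C by rewrite expf_neq0.
have cancel_powers (x y u v w f s z : C) : f != 0 -> u != 0 -> v != 0 -> w != 0 ->
    x / u * (y / v) * (f^-1 * w) * (s / w * (u * v) * z) = s * x * y / f * z.
  by move=> f0' u0 v0 w0; field; rewrite f0' u0 v0 w0.
exact: cancel_powers.
Qed.

(** This is [fuss_neg] with P = pK and M = qK. As b is not a negative integer, (b + 1)_(pK) can be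
    divided out. *)
Lemma Fq_coef b t K : (forall i : nat, b + i.+1%:R != 0) ->
  hypergeom_coef (Fq_upper p q b) (Fq_lower p q b) K * zeta_of p q t 1 ^+ K =
  fuss_term (- p%:R / q%:R) (- b) t (q * K).
Proof.
move=> hb.
have hpb : pochhammer (b + 1) (p * K) != 0.
  by apply: pochhammer_neq0 => i _; rewrite -addrA nat1r.
rewrite /hypergeom_coef /Fq_lower big_cat !prod_pochhammer_seq //=.
rewrite -[_ * _ * K`!%:R]mulrA prod_pochhammer_fact //.
rewrite /fuss_term; have -> : fuss (- p%:R / q%:R) (- b) (q * K) =
  (-1) ^+ (q * K) * pochhammer b ((p + q) * K) / (pochhammer (b + 1) (p * K) * (q * K)`!%:R).
  case: K hpb => [|K] hpb.
    by rewrite !muln0 /pochhammer !big_ord0 fact0 expr0 !mul1r invr1.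
  apply: (mulIf hpb); rewrite fuss_neg ?muln_gt0 ?q_gt0 //; last first.
    by rewrite !natrM; field.
  rewrite -mulnDl; have f0 := fact_neq0 C (q * K.+1); set F := _`!%:R in f0 *.
  by field; rewrite f0 hpb.
rewrite !addr0 zeta_ofE expr1n divr1 !exprMn !exprVn !exprMn -!exprM.
have f0 := fact_neq0 C (q * K).
have pK : p%:R ^+ (p * K) != 0 :> C by rewrite expf_neq0.
have qK : q%:R ^+ (q * K) != 0 :> C by rewrite expf_neq0.
have nK : (p + q)%:R ^+ ((p + q) * K) != 0 :> C by rewrite expf_neq0.
have cancel_powers (x y f s z u v w : C) : y != 0 -> f != 0 -> u != 0 -> v != 0 -> w != 0 ->
    x / w / (y / u * (f / v)) * (s * w / (u * v) * z) = s * x / (y * f) * z.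
  by move=> y0 f0' u0 v0 w0; field; rewrite y0 f0' u0 v0 w0.
exact: cancel_powers.
Qed.

(** The lower parameters i/q are positive, so only some (a + j)/p can be -m1. Conversely, for a =
    -(N + 1), dividing N by p and N + 1 by p + q gives m1 and m2. From m2 (p + q) <= N + 1 and q >=
    1 follows m2 p <= N unless m2 = 0, hence m2 <= m1. *)
Lemma degenerateP a :
  degenerate (Fq_upper p q a) (Fq_lower p q a) <-> exists i : nat, a + i.+1%:R = 0.
Proof.
split=> [[m1 [m2 [h _ _]]]|[N aN]].
  move: h; rewrite mem_cat => /orP[|] /mapP[j]; rewrite mem_iota => /andP[j1 _] /eqP.
    case: j j1 => // j _; rewrite eq_sym -subr_eq0 opprK => /eqP e.
    exists (j + p * m1)%N; apply: (mulIf (invr_neq0 p0)); rewrite mul0r -{}e.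
    by rewrite -addSn natrD natrM; field.
  rewrite eq_sym -subr_eq0 opprK => /eqP e.
  suff : 0 < j%:R / q%:R + m1%:R :> C by rewrite e ltxx.
  by rewrite ltr_wpDr // divr_gt0 ?ltr0n.
have aE : a = - N.+1%:R by apply/eqP; rewrite -addr_eq0 aN.
exists (N %/ p)%N, (N.+1 %/ (p + q))%N; split.
- rewrite mem_cat; apply/orP; left; apply/mapP; exists (N %% p).+1.
    by rewrite mem_iota ltnS leq0n add1n ltnS ltn_mod.
  have eN : N%:R = (N %/ p)%:R * p%:R + (N %% p)%:R :> C by rewrite -natrM -natrD -divn_eq.
  by apply: (mulIf p0); rewrite divfK // aE -!natr1 eN; ring.
- apply/mapP; exists (N.+1 %% (p + q))%N; first by rewrite mem_iota add0n ltn_mod.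
  have eN : N.+1%:R = (N.+1 %/ (p + q))%:R * (p + q)%:R + (N.+1 %% (p + q))%:R :> C.
    by rewrite -natrM -natrD -divn_eq.
  by apply: (mulIf n0); rewrite divfK // aE eN; ring.
- rewrite leq_divRL //; case E : (_ %/ _)%N => [|m] //.
  have := leq_trunc_div N.+1 (p + q); rewrite E mulnDr => h.
  rewrite -ltnS; apply: leq_trans h; rewrite -addn1 leq_add2l.
  by rewrite muln_gt0 q_gt0.
Qed.

(* For a = -1, -2, ... the coefficients of the series are undefined, but the
   right-hand side is continuous in a. *)
Lemma Fq_average a B w t : q.-primitive_root w ->
  `|a| + `|- p%:R / q%:R| + 2 <= B -> 16 * B ^+ 2 * `|t| <= 1 ->
  Fq p q a (zeta_of p q t 1) =
  q%:R^-1 * \sum_(j < q) fuss_fun (- p%:R / q%:R) (- a) (w ^+ j * t).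
Proof.
move=> hw hB ht; set tau := - p%:R / q%:R in hB *.
have hb b : `|b - a| <= 1 -> `|- b| + `|tau| + 1 <= B.
  move=> b1; apply: le_trans hB; rewrite normrN.
  have -> : `|a| + `|tau| + 2 = (1 + `|a|) + `|tau| + 1 by ring.
  rewrite !lerD2r -[b in leLHS](subrK a); apply: le_trans (ler_normD _ _) _.
  by rewrite lerD2r.
have w1 j := norm_prim_root_mul j t hw.
rewrite /Fq; case: asboolP => [/degenerateP[N aN]|ndeg]; last first.
  apply: (hypergeom_fuss hw _ ht); first by apply: hb; rewrite subrr normr0 ler01.
  move=> K; apply: Fq_coef => i; apply/eqP => ai.
  by apply: ndeg; apply/degenerateP; exists i.
apply: (cvg_lim chaus).
apply: (@cvg_trans _ (q%:R^-1 * \sum_(j < q) fuss_fun tau (- b) (w ^+ j * t) @[b --> a^'])).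
  apply: near_eq_cvg; near=> b.
  have b1 : `|b - a| < 1.
    near: b; apply: cvg_within.
    by have /(@cvgr0Pnorm_lt C C _ (nbhs a))/(_ _ (@ltr01 C)) := @cvg_subr_self C a.
  have ba : b != a by near: b; exact: nbhs_dnbhs_neq.
  symmetry; apply: (hypergeom_fuss hw _ ht); first by apply: hb; exact: ltW.
  move=> K; apply: Fq_coef => i; apply/eqP => bi.
  (* If [b] were a negative integer too, [a] and [b] would be distinct integers at distance less
     than 1. *)
  have e : b - a = N%:R - i%:R.
    have bE : b = - i.+1%:R by apply/eqP; rewrite -addr_eq0 bi.
    have aE : a = - N.+1%:R by apply/eqP; rewrite -addr_eq0 aN.
    by rewrite bE aE -!natr1; ring.
  have [Ni|iN|Ni] := ltngtP N i; last by move: ba; rewrite -subr_eq0 e Ni subrr eqxx.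
    move: b1; rewrite e distrC -(natrB _ (ltnW Ni)) normr_nat -[X in _ < X]/(1%:R) ltr_nat ltnS leqn0 subn_eq0.
    by rewrite leqNgt Ni.
  move: b1; rewrite e -(natrB _ (ltnW iN)) normr_nat -[X in _ < X]/(1%:R) ltr_nat ltnS leqn0 subn_eq0.
  by rewrite leqNgt iN.
apply: (@cvg_within_filter _ _ _ (nbhs a)).
apply: (@cvgMl_cst _ _ (nbhs a)).
apply: cvg_big => [|j _]; first exact: add_continuous.
apply: (@cvg_comp _ _ _ -%R (fun b => fuss_fun tau b (w ^+ j * t)) (nbhs a) (nbhs (- a))).
  exact: (@cvgN C C C (nbhs a) _ id a cvg_id).
by apply: (fuss_fun_cvg_param hC (B := B)); rewrite ?normrN // w1.
Unshelve. all: by end_near. Qed.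

Lemma Fn_average a B w t : (p + q).-primitive_root w ->
  `|a| + `|p%:R / (p + q)%:R| + 1 <= B -> 16 * B ^+ 2 * `|t| <= 1 ->
  Fn p q a (zeta_of p q 1 t)^-1 =
  (p + q)%:R^-1 * \sum_(j < p + q) fuss_fun (p%:R / (p + q)%:R) (- a) (w ^+ j * t).
Proof.
move=> hw hB ht; apply: (hypergeom_fuss hw _ ht); first by rewrite normrN.
by move=> K; exact: Fn_coef.
Qed.

End HypergeomFuss.

(** * Functions on Schwarz curves *)

Section Forms.
Variables (C : numClosedFieldType) (k : nat).
Implicit Types (P : mpoly k C) (x : 'I_k -> C) (s : 'S_k).

Definition coord (j : 'I_k) : mpoly k C := mpolyX C (mnm1 j).

Lemma meval_coord x j : meval x (coord j) = x j.
Proof. exact: mevalXU. Qed.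

Lemma dhomog_coord j : coord j \is ishomog1 1 mdeg.
Proof. by rewrite /coord dhomogX /= mdeg1. Qed.

Lemma dhomog_coordX j d : coord j ^+ d \is ishomog1 d mdeg.
Proof. by rewrite -[d in ishomog1 d]mul1n dhomogMn // dhomog_coord. Qed.

Lemma dhomog_prod_const (A : pred 'I_k) (f : 'I_k -> mpoly k C) d :
  (forall j, f j \is ishomog1 d mdeg) ->
  \prod_(j | A j) f j \is ishomog1 (#|A| * d) mdeg.
Proof.
move=> hf; rewrite -sum_nat_const.
apply: (big_ind2 (fun (P : mpoly k C) e => P \is ishomog1 e mdeg)) => //.
- exact: dhomog1.
- by move=> ? ? ? ?; exact: dhomogM.
Qed.

Lemma meval_scale P d l x : P \is ishomog1 d mdeg ->
  meval (fun j => l * x j) P = l ^+ d * meval x P.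
Proof.
move=> /dhomogP hP; rewrite !mevalE mulr_sumr; apply: eq_big_seq => m /hP md.
rewrite mulrCA; congr (_ * _); under eq_bigr do rewrite exprMn.
by rewrite big_split /= prodrXr -mdegE md.
Qed.

(** A Lagrange resolvent of the [y j] when c is a k-th root of unity. *)
Definition cyclic_form (c : C) (y : 'I_k -> mpoly k C) : mpoly k C :=
  \sum_(j < k) c ^+ j *: y j.

Lemma meval_cyclic_form c y x :
  meval x (cyclic_form c y) = \sum_(j < k) c ^+ j * meval x (y j).
Proof. by rewrite raddf_sum; apply: eq_bigr => j _; exact: mevalZ. Qed.

Lemma dhomog_cyclic_form c y d : (forall j, y j \is ishomog1 d mdeg) ->
  cyclic_form c y \is ishomog1 d mdeg.
Proof. by move=> hy; apply: rpred_sum => j _; apply: rpredZ. Qed.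

(* A cyclic shift of the roots multiplies the form by a root of unity. *)
Lemma cyclic_form_invariant c y s x : c ^+ k = 1 ->
  (forall s x j, meval (x \o s) (y j) = meval x (y (s j))) ->
  s \in <[cyclic_shift k]>%g ->
  meval (x \o s) (cyclic_form c y) ^+ k = meval x (cyclic_form c y) ^+ k.
Proof.
move=> ck hy /cycleP[N ->]; elim: N x => [|N IH] x.
  rewrite expg0; congr (meval _ _ ^+ _); apply/funext => j /=.
  by rewrite perm1.
rewrite expgS -[RHS]IH.
have -> : x \o (cyclic_shift k * cyclic_shift k ^+ N)%g =
    (x \o (cyclic_shift k ^+ N)%g) \o cyclic_shift k.
  by apply/funext => j /=; rewrite permM.
move: (x \o _) => {IH} z.
have -> : meval z (cyclic_form c y) = c * meval (z \o cyclic_shift k) (cyclic_form c y).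
  rewrite !meval_cyclic_form (reindex_inj (@perm_inj _ (cyclic_shift k))) mulr_sumr.
  apply: eq_bigr => j _; rewrite hy mulrA; congr (_ * _).
  by rewrite permE /= -exprS expr_mod.
by rewrite exprMn ck mul1r.
Qed.

Lemma cyclic_quotient_function (cone : set ('I_k -> C)) cmap c y e G H dG d :
  c ^+ k = 1 -> (forall s x j, meval (x \o s) (y j) = meval x (y (s j))) ->
  (forall j, y j \is ishomog1 e mdeg) ->
  G \is ishomog1 dG mdeg -> H \is ishomog1 d mdeg -> (dG + e * k = d)%N ->
  (exists2 x, cone x & meval x H != 0) ->
  (forall s x, s \in <[cyclic_shift k]>%g -> cone x ->
     meval (x \o s) G * meval x H = meval x G * meval (x \o s) H) ->
  @function_on_quotient C (Curve cone cmap <[cyclic_shift k]>%g)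
    (G * cyclic_form c y ^+ k) H.
Proof.
move=> ck hy ye Gd Hd dE hH hinv; split=> //.
  exists d; split=> //; rewrite -dE; apply: dhomogM => //.
  by apply: dhomogMn; exact: dhomog_cyclic_form.
move=> s x hs xc; rewrite !mevalM !rmorphXn /= (cyclic_form_invariant _ ck hy hs).
by rewrite mulrAC (hinv s x hs xc) mulrAC.
Qed.

End Forms.

(** * Roots of trinomials on the Schwarz cone *)

Section SchwarzCone.
Variables (C : numClosedFieldType) (p q k : nat).

Lemma schwarz_points_cone (x : 'I_k -> C) : schwarz_points p q x -> schwarz_cone p q x.
Proof. by move=> hx; split=> [|d P _]; [case: hx|apply]. Qed.

Lemma trinomial_root (g b : C) (x : 'I_k -> C) j : trinomial_roots p q g b x ->
  x j ^+ (p + q) = g * x j ^+ p + b.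
Proof.
move=> [r tE]; have : (trinomial p q g b).[x j] = 0.
  by rewrite tE hornerM horner_prod (bigD1 j) //= hornerXsubC subrr !mul0r.
rewrite /trinomial !hornerE => /eqP.
by rewrite -addrA -opprD subr_eq0 => /eqP.
Qed.

(* The coefficient g of the trinomial, as a function of two of its roots. *)
Lemma schwarz_slope_invariant (j0 j1 : 'I_k) (s : 'S_k) (x : 'I_k -> C) :
  schwarz_cone p q x ->
  (x (s j0) ^+ (p + q) - x (s j1) ^+ (p + q)) * (x j0 ^+ p - x j1 ^+ p) =
  (x j0 ^+ (p + q) - x j1 ^+ (p + q)) * (x (s j0) ^+ p - x (s j1) ^+ p).
Proof.
case=> _ hx; apply/eqP; rewrite -subr_eq0; apply/eqP.
pose X := @coord C k.
(* On [schwarz_points] both products equal g times the same two differences of p-th powers. The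
   difference is a form of degree (p + q) + p, so its vanishing passes to the closure. *)
have := hx (p + q + p)%N ((X (s j0) ^+ (p + q) - X (s j1) ^+ (p + q)) * (X j0 ^+ p - X j1 ^+ p) -
  (X j0 ^+ (p + q) - X j1 ^+ (p + q)) * (X (s j0) ^+ p - X (s j1) ^+ p)).
rewrite !(mevalM, mevalB) !rmorphXn /= !meval_coord; apply.
  by apply: rpredB; apply: dhomogM; apply: rpredB; exact: dhomog_coordX.
move=> y [_ [g [b [_ hr]]]].
rewrite !(mevalM, mevalB) !rmorphXn /= !meval_coord !(trinomial_root _ hr).
by ring.
Qed.

Let size_trinomial_tail (g b : C) : (0 < q)%N ->
  (size (- (g *: 'X^p) - b%:P)%R <= p + q)%N.
Proof.
move=> q0; apply: leq_trans (size_polyD _ _) _; rewrite geq_max !size_polyN.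
apply/andP; split.
  apply: leq_trans (size_scale_leq _ _) _.
  by rewrite size_polyXn -[X in (X < _)%N]addn0 ltn_add2l.
by apply: leq_trans (size_polyC_leq1 _) _; apply: leq_trans q0 (leq_addl _ _).
Qed.

Lemma size_trinomial (g b : C) : (0 < q)%N -> size (trinomial p q g b) = (p + q).+1.
Proof.
move=> q0; rewrite /trinomial -addrA size_polyDl size_polyXn // ltnS.
exact: size_trinomial_tail.
Qed.

Lemma trinomial_monic (g b : C) : (0 < q)%N -> trinomial p q g b \is monic.
Proof.
move=> q0; rewrite monicE /trinomial -addrA lead_coefDl ?lead_coefXn //.
by rewrite size_polyXn ltnS size_trinomial_tail.
Qed.

(** Distinct roots split off as linear factors; the cofactor is monic and splits over the
    algebraically closed field. *)
Lemma trinomial_roots_uniq (g b : C) (x : 'I_k -> C) : (0 < q)%N -> injective x ->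
  (forall j, x j ^+ (p + q) = g * x j ^+ p + b) -> trinomial_roots p q g b x.
Proof.
move=> q0 xinj hx.
have [Q tE] : exists Q, trinomial p q g b = Q * \prod_(z <- codom x) ('X - z%:P).
  apply: uniq_roots_prod_XsubC.
    apply/allP => _ /codomP[j ->]; rewrite /root /trinomial !hornerE hx.
    by rewrite addrAC addrK subrr.
  by rewrite uniq_rootsE; apply/injectiveP.
have tm := trinomial_monic g b q0.
have [r QE] := closed_field_poly_normal Q.
exists r; rewrite tE mulrC big_image /=; congr (_ * _).
have Qm : Q \is monic.
  rewrite -(monicMl _ (monic_prod_XsubC (codom x) xpredT id)) // mulrC -tE //.
by rewrite {1}QE (monicP Qm) scale1r.
Qed.

(** Vieta's formula for the constant term: comparing degrees, n roots leave no further linear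
    factor, and both sides are evaluated at 0. *)
Lemma prod_trinomial_roots (g b : C) (x : 'I_(p + q) -> C) : (0 < p)%N -> (0 < q)%N ->
  trinomial_roots p q g b x -> (-1) ^+ (p + q) * \prod_j x j = - b.
Proof.
move=> p0 q0 [r tE].
have Am := monic_prod_XsubC (index_enum 'I_(p + q)) xpredT x.
have r0 : r = [::].
  have Bm := monic_prod_XsubC r xpredT id.
  have := congr1 (fun P : {poly C} => size P) tE; rewrite /= size_trinomial //.
  rewrite size_Mmonic ?monic_neq0 // !size_prod_XsubC -[X in size X]enumT size_enum_ord.
  by rewrite addSn addnS /= -[LHS]addn0 => -[] /addnI /esym /size0nil.
have := congr1 (fun P : {poly C} => P.[0]) tE.
rewrite r0 big_nil mulr1 /trinomial !hornerE !expr0n !gtn_eqF ?addn_gt0 ?p0 //.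
rewrite mulr0 subr0 add0r => ->; rewrite horner_prod.
rewrite -[X in _ ^+ X]card_ord -prodr_const -big_split /=; apply: eq_bigr => j _.
by rewrite hornerXsubC sub0r mulN1r.
Qed.

End SchwarzCone.

(** * Cyclically invariant functions of the roots *)

Section SchwarzFunction.
Variables (C : numClosedFieldType) (p q k : nat).
Implicit Types (x : 'I_k -> C) (s : 'S_k).

(* On the charts below, U / V takes the value 1 and makes a function of the roots
   homogeneous of degree 0. *)
Lemma schwarz_cone_function (U V : mpoly k C) dU dV (c : C) (m : int) cmap :
  (0 < k)%N -> c ^+ k = 1 ->
  U \is ishomog1 dU mdeg -> V \is ishomog1 dV mdeg -> dU = (dV + k)%N ->
  (forall s x, s \in <[cyclic_shift k]>%g -> schwarz_cone p q x ->
     meval (x \o s) U * meval x V = meval x U * meval (x \o s) V) ->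
  (exists x, [/\ schwarz_cone p q x, meval x U != 0, meval x V != 0 & forall j, x j != 0]) ->
  exists num den : mpoly k C,
    @function_on_quotient C (Curve (@schwarz_cone C p q k) cmap <[cyclic_shift k]>%g) num den /\
    forall x, meval x U = meval x V -> meval x V != 0 -> (forall j, x j != 0) ->
      meval x den != 0 /\
      meval x num / meval x den = (k%:R^-1 * \sum_(j < k) c ^+ j * (x j) ^ (- m)) ^+ k.
Proof.
move=> k0 ck Ud Vd dE hinv [x0 [x0c U0 V0 x00]].
have kn0 : k%:R != 0 :> C by rewrite pnatr_eq0 -lt0n.
have kk0 : k%:R ^+ k != 0 :> C by rewrite expf_neq0.
case: m => L.
  (* For m = L >= 0 the powers x_j^(-L) are brought over the common denominator W^L. The k-th power
     of their sum has degree -kL, which (U / V)^L compensates since dU - dV = k. *)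
  pose y j : mpoly k C := \prod_(i | i != j) coord C i ^+ L.
  pose W : mpoly k C := \prod_i coord C i.
  have yE x j : meval x (y j) = \prod_(i | i != j) x i ^+ L.
    by rewrite rmorph_prod; apply: eq_bigr => i _; rewrite rmorphXn /= meval_coord.
  have WE x : meval x W = \prod_i x i.
    by rewrite rmorph_prod /=; apply: eq_bigr => i _; rewrite meval_coord.
  have W0 x : (forall j, x j != 0) -> meval x W != 0.
    by move=> hx; rewrite WE; apply/prodf_neq0.
  have Ws s x : meval (x \o s) W = meval x W.
    by rewrite !WE [RHS](reindex_inj (@perm_inj _ s)).
  pose H := k%:R ^+ k *: (V ^+ L * W ^+ (L * k)).
  have HE x : meval x H = k%:R ^+ k * (meval x V ^+ L * meval x W ^+ (L * k)).
    by rewrite mevalZ mevalM !rmorphXn.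
  exists (U ^+ L * cyclic_form c y ^+ k), H; split.
    apply: (@cyclic_quotient_function _ _ _ _ _ _ (k.-1 * L) _ _ (dU * L)
      (dV * L + k * (L * k))) => //.
    - move=> s x j; rewrite !yE (reindex_inj (@perm_inj _ s^-1%g)) /=.
      apply: eq_big => [i|i _]; last by rewrite permKV.
      by rewrite (canF_eq (permKV s)).
    - move=> j; have := @dhomog_prod_const C k (predC1 j) (fun i => coord C i ^+ L) L _.
      by rewrite cardC1 card_ord; apply=> i; exact: dhomog_coordX.
    - exact: dhomogMn.
    - apply: dhomogZ; apply: dhomogM; first exact: dhomogMn.
      apply: dhomogMn; have := @dhomog_prod_const C k predT (@coord C k) 1 _.
      by rewrite muln1 -[#|predT|]/(#|'I_k|) card_ord; apply=> i; exact: dhomog_coord.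
    - rewrite dE; case: (k) k0 => // k' _; rewrite /=; nia.
    - exists x0 => //; rewrite HE !mulf_neq0 ?expf_neq0 //; exact: W0.
    - move=> s x hs hx; rewrite !HE Ws !rmorphXn /=.
      have := congr1 (fun z => z ^+ L) (hinv s x hs hx); rewrite /= !exprMn => h.
      by rewrite mulrCA !mulrA -[_ * _ * meval x V ^+ L]mulrA h; ring.
  move=> x UV V1 x1; have W1 := W0 x x1.
  have H1 : meval x H != 0 by rewrite HE !mulf_neq0 ?expf_neq0.
  split=> //; rewrite mevalM !rmorphXn /= meval_cyclic_form HE UV.
  have -> : \sum_(j < k) c ^+ j * (x j) ^ (- Posz L) =
      (\sum_(j < k) c ^+ j * meval x (y j)) / meval x W ^+ L.
    rewrite mulr_suml; apply: eq_bigr => j _; rewrite -mulrA; congr (_ * _).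
    rewrite yE WE -prodrXl [X in _ = _ / X](bigD1 j) //= invfM mulrCA divff ?mulr1; last first.
      by apply/prodf_neq0 => i _; rewrite expf_neq0.
    by rewrite -exprnN.
  rewrite !exprMn !exprVn -exprM.
  have VL : meval x V ^+ L != 0 by rewrite expf_neq0.
  have WL : meval x W ^+ (L * k) != 0 by rewrite expf_neq0.
  have cancel_norm (a b d f : C) : a != 0 -> b != 0 -> d != 0 ->
    a * f / (d * (a * b)) = d^-1 * (f / b).
    by move=> a0 b0 d0; field; rewrite a0 b0 d0.
  exact: cancel_norm.
(* For m = -(L + 1) the powers are polynomial, and (V / U)^(L+1) compensates the degree. *)
pose y j : mpoly k C := coord C j ^+ L.+1.
have yE x j : meval x (y j) = x j ^+ L.+1 by rewrite rmorphXn /= meval_coord.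
pose H := k%:R ^+ k *: U ^+ L.+1.
have HE x : meval x H = k%:R ^+ k * meval x U ^+ L.+1 by rewrite mevalZ rmorphXn.
exists (V ^+ L.+1 * cyclic_form c y ^+ k), H; split.
  apply: (@cyclic_quotient_function _ _ _ _ _ _ L.+1 _ _ (dV * L.+1) (dU * L.+1)) => //.
  - by move=> s x j; rewrite !yE.
  - by move=> j; exact: dhomog_coordX.
  - exact: dhomogMn.
  - by apply: dhomogZ; exact: dhomogMn.
  - by rewrite dE mulnDl (mulnC k).
  - by exists x0 => //; rewrite HE !mulf_neq0 ?expf_neq0.
  - move=> s x hs hx; rewrite !HE !rmorphXn /=.
    have := congr1 (fun z => z ^+ L.+1) (hinv s x hs hx); rewrite /= !exprMn => h.
    by rewrite mulrCA [RHS]mulrCA; congr (_ * _); rewrite mulrC [RHS]mulrC h.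
move=> x UV V1 x1.
have H1 : meval x H != 0 by rewrite HE !mulf_neq0 ?expf_neq0 // UV.
split=> //; rewrite mevalM !rmorphXn /= meval_cyclic_form HE UV.
have -> : \sum_(j < k) c ^+ j * x j ^ (- Negz L) =
    \sum_(j < k) c ^+ j * meval x (y j).
  by apply: eq_bigr => j _; rewrite yE NegzE opprK.
rewrite exprMn exprVn.
have cancel_norm (a d f : C) : a != 0 -> d != 0 -> a * f / (d * a) = d^-1 * f.
  by move=> a0 d0; field; rewrite a0 d0.
by apply: cancel_norm => //; rewrite expf_neq0.
Qed.

End SchwarzFunction.

(** * Local charts *)

Section Chart.
Variable C : numClosedFieldType.
Hypothesis hC : geometric_complete C.

Lemma near0_scale (d : C) (P : C -> Prop) :
  (\forall t \near (0 : C), P t) -> \forall t \near (0 : C), P (d * t).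
Proof.
have h : (d * t) @[t --> (0 : C)] --> (0 : C).
  by rewrite -[X in _ --> X](mulr0 d); exact: (@cvgMl_cst _ _ (nbhs (0 : C)) _ id).
exact: h.
Qed.

Lemma near0_dnbhs (P : C -> Prop) :
  (\forall t \near (0 : C), P t) -> \forall t \near (0 : C)^', P t.
Proof. by move=> h; apply: cvg_within. Qed.

Lemma near_neq (f : C -> C) (a b : C) : f t @[t --> (0 : C)] --> a -> a != b ->
  \forall t \near (0 : C), f t != b.
Proof.
move=> /(@cvgrPdist_lt C C _ (nbhs (0 : C))) cf ab.
have d0 : 0 < `|a - b| by rewrite normr_gt0 subr_eq0.
apply: filterS (cf _ d0) => t; apply: contraTneq => ->.
by rewrite ltxx.
Qed.

Lemma analytic0_fuss_fun (tau r c d : C) :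
  analytic0 (fun t => c * fuss_fun tau r (d * t)).
Proof.
exists (fun i => c * (fuss tau r i * d ^+ i)).
pose B := `|r| + `|tau| + 1.
have B1 : 1 <= B by rewrite lerDr addr_ge0.
near=> t.
rewrite (_ : series _ = fun N => c * series (fuss_term tau r (d * t)) N).
  apply: cvgMl_cst; apply: tame_cvg => //; apply: (tame_fuss (B := B)) => //.
  by near: t; apply: (@near0_scale d (fun t => 16 * B ^+ 2 * `|t| <= 1)); exact: near0_small.
apply/funext => N; rewrite !seriesEnat /= mulr_sumr; apply: eq_bigr => i _.
by rewrite /fuss_term exprMn !mulrA.
Unshelve. all: by end_near. Qed.

Variables (k : nat) (e : int).
Hypothesis k_gt0 : (0 < k)%N.
Let k0 : k%:R != 0 :> C. Proof. by rewrite pnatr_eq0 -lt0n. Qed.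

Let tau : C := e%:~R / k%:R.
Let X (t : C) : C := fuss_fun tau k%:R^-1 t.

Lemma near_fuss_exp (m : int) :
  \forall t \near (0 : C), fuss_fun tau (m%:~R / k%:R) t = X t ^ m.
Proof.
pose B := `|k%:R^-1 *~ m| + `|tau| + 1.
have B1 : 1 <= B by rewrite lerDr addr_ge0.
near=> t; rewrite mulrzl; apply: (fuss_funMz hC (B := B)) => //.
by near: t; exact: near0_small.
Unshelve. all: by end_near. Qed.

Lemma near_fuss_neq0 : \forall t \near (0 : C), X t != 0.
Proof. by apply: near_neq (oner_neq0 _); exact: fuss_fun_cvg. Qed.

(** The identity A_1 = 1 + t A_tau, with A_1 = X^k and A_tau = X^e. *)
Lemma near_fuss_root : \forall t \near (0 : C), X t ^+ k = 1 + t * X t ^ e.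
Proof.
have h1 := near_fuss_exp k; have h2 := near_fuss_exp e.
pose B := 1 + `|tau| + `|tau| + 1.
have B1 : 1 <= B by rewrite lerDr !addr_ge0.
near=> t.
have e1 : fuss_fun tau (k%:~R / k%:R) t = X t ^+ k by near: t; exact: h1.
have e2 : fuss_fun tau tau t = X t ^ e by near: t; exact: h2.
rewrite -e1 -e2 divff //; apply: (fuss_fun1 hC (B := B)).
- by rewrite lerD2r lerDl.
- by rewrite lerD2r -addrA lerDr.
- by near: t; exact: near0_small.
Unshelve. all: by end_near. Qed.

(** The difference of the k-th powers is that of the values times a sum of k monomials, which tends
    to k and so does not vanish near (0, 0). *)
Lemma near_fuss_sep : \forall u \near (nbhs (0 : C), nbhs (0 : C)),
  X u.1 ^+ k = X u.2 ^+ k -> X u.1 = X u.2.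
Proof.
have c1 : X u.1 @[u --> (nbhs (0 : C), nbhs (0 : C))] --> (1 : C).
  apply: (@cvg_comp _ _ _ fst X _ (nbhs (0 : C))); first exact: cvg_fst.
  exact: fuss_fun_cvg.
have c2 : X u.2 @[u --> (nbhs (0 : C), nbhs (0 : C))] --> (1 : C).
  apply: (@cvg_comp _ _ _ snd X _ (nbhs (0 : C))); first exact: cvg_snd.
  exact: fuss_fun_cvg.
have cX (f : C * C -> C) n : f u @[u --> (nbhs (0 : C), nbhs (0 : C))] --> (1 : C) ->
    f u ^+ n @[u --> (nbhs (0 : C), nbhs (0 : C))] --> (1 : C).
  move=> cf; elim: n => [|n IH]; first exact: cvg_cst.
  have -> : (fun u => f u ^+ n.+1) = f \* (fun u => f u ^+ n).
    by apply/funext => u /=; rewrite exprS.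
  have h := cvgM cf IH; rewrite mulr1 in h; exact: h.
have cS : (\sum_(i < k) X u.1 ^+ (k.-1 - i) * X u.2 ^+ i)
    @[u --> (nbhs (0 : C), nbhs (0 : C))] --> (k%:R : C).
  have -> : k%:R = \sum_(i < k) (1 * 1) :> C by rewrite mulr1 sumr_const card_ord.
  apply: cvg_big => [|i _]; first exact: add_continuous.
  by apply: cvgM; exact: cX.
have k1 : 0 < `|k%:R : C| by rewrite normr_gt0.
move/cvgrPdist_lt/(_ _ k1): cS; apply: filterS => u hu /eqP.
rewrite -subr_eq0 subrXX mulf_eq0 subr_eq0 => /orP[/eqP //|/eqP S0].
by move: hu; rewrite S0 subr0 ltxx.
Qed.

Variables eta eta' : C.
Hypothesis eta_prim : k.-primitive_root eta.

Definition root_chart (t : C) (j : 'I_k) : C := eta ^+ j * X (eta' ^+ j * t).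

Lemma root_chart_cvg j : root_chart t j @[t --> (0 : C)] --> eta ^+ j.
Proof.
rewrite -[X in _ --> X]mulr1; apply: (@cvgMl_cst _ _ (nbhs (0 : C))).
apply: (@cvg_comp _ _ _ (fun t => eta' ^+ j * t) X (nbhs (0 : C)) (nbhs (0 : C))).
  by move=> P; exact: (@near0_scale (eta' ^+ j) P).
exact: fuss_fun_cvg.
Qed.

(** At t = 0 the coordinates tend to distinct powers of [eta]. *)
Lemma near_root_chart_inj : \forall t \near (0 : C), injective (root_chart t).
Proof.
have h (u : 'I_k * 'I_k) : \forall t \near (0 : C),
    root_chart t u.1 = root_chart t u.2 -> u.1 = u.2.
  have [->|u12] := eqVneq u.1 u.2; first by near=> t.
  have : \forall t \near (0 : C), root_chart t u.1 - root_chart t u.2 != 0.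
    apply: (@near_neq _ (eta ^+ u.1 - eta ^+ u.2)).
      by apply: (@cvgB C C C (nbhs (0 : C))); exact: root_chart_cvg.
    rewrite subr_eq0 (eq_prim_root_expr eta_prim) /eqn !modn_small //.
  by apply: filterS => t; rewrite subr_eq0 => /eqP.
apply: filterS (@filter_forall _ _ _ (nbhs (0 : C)) _ h) => t ht i j.
exact: (ht (i, j)).
Unshelve. all: by end_near. Qed.


Variables p q : nat.
Hypothesis q_gt0 : (0 < q)%N.

(** Common to (i) and (ii). The quotient U / V, equal to 1 on the chart, stands for g in (i) and for
    b in (ii), each of degree k in the roots. *)
Lemma uniformized_by_schwarz (F : C -> C) (base : set_system C) (m : int)
    (U V : mpoly k C) dU dV (g b z : C -> C) :
  U \is ishomog1 dU mdeg -> V \is ishomog1 dV mdeg -> dU = (dV + k)%N ->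
  (forall s x, s \in <[cyclic_shift k]>%g -> schwarz_cone p q x ->
     meval (x \o s) U * meval x V = meval x U * meval (x \o s) V) ->
  (\forall t \near (0 : C), [/\ (g t != 0) || (b t != 0),
     forall j, root_chart t j ^+ (p + q) = g t * root_chart t j ^+ p + b t,
     meval (root_chart t) U = meval (root_chart t) V & meval (root_chart t) V != 0]) ->
  z t @[t --> (0 : C)^'] --> base ->
  (\forall t \near (0 : C)^', [/\ g t != 0, z t = zeta_of p q (b t) (g t) &
     F (z t) = (k%:R^-1 * \sum_(j < k) fuss_fun tau ((- m)%:~R / k%:R) (eta' ^+ j * t)) ^+ k]) ->
  uniformized_by F base
    (Curve (@schwarz_cone C p q k) (@schwarz_cover C p q k) <[cyclic_shift k]>%g).
Proof.
move=> Ud Vd dE hinv hchart hz hF.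
pose x := root_chart.
have near_coord (P : C -> Prop) : (\forall t \near (0 : C), P t) ->
    \forall t \near (0 : C), forall j : 'I_k, P (eta' ^+ j * t).
  by move=> hP; apply: (@filter_forall _ _ _ (nbhs (0 : C))) => j; exact: near0_scale.
have hX0 := near_coord _ near_fuss_neq0.
have hXm := near_coord _ (near_fuss_exp (- m)).
have eta0 : eta != 0 by rewrite (prim_root_eq0 eta_prim) -lt0n.
have hx0 : \forall t \near (0 : C), forall j, x t j != 0.
  apply: filterS hX0 => t ht j; rewrite mulf_neq0 ?expf_neq0 //; exact: ht.
have hroots : \forall t \near (0 : C), trinomial_roots p q (g t) (b t) (x t).
  near=> t; have [_ ht _ _] : [/\ (g t != 0) || (b t != 0),
     forall j, root_chart t j ^+ (p + q) = g t * root_chart t j ^+ p + b t,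
     meval (root_chart t) U = meval (root_chart t) V & meval (root_chart t) V != 0].
    by near: t; exact: hchart.
  by apply: trinomial_roots_uniq => //; near: t; exact: near_root_chart_inj.
have hcone : \forall t \near (0 : C), schwarz_cone p q (x t).
  apply: filterS3 hchart hroots hx0 => t [gb _ _ _] ht ht0.
  apply: schwarz_points_cone; split; first by exists (Ordinal k_gt0).
  by exists (g t), (b t).
have etam : (eta ^ m) ^+ k = 1.
  by rewrite exprnP exprz_exp mulrC -exprz_exp -exprnP (prim_expr_order eta_prim) exp1rz.
(* The weights (eta^m)^j cancel the factors eta^(-jm) of x_j^(-m), leaving the plain average of
   X^(-m) over the points eta'^j t. *)
have [|num [den [hnd hval]]] := @schwarz_cone_function C p q k U V dU dV (eta ^ m) m
  (@schwarz_cover C p q k) k_gt0 etam Ud Vd dE hinv.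
  near (0 : C) => t; exists (x t); split.
  - by near: t.
  - by near: t; apply: filterS hchart => t [_ _ -> ].
  - by near: t; apply: filterS hchart => t [].
  - by near: t.
exists num, den; split=> //; exists x; split; last first.
  exists z => //; near=> t.
  have [gt0 zt ->] : [/\ g t != 0, z t = zeta_of p q (b t) (g t) &
     F (z t) = (k%:R^-1 * \sum_(j < k) fuss_fun tau ((- m)%:~R / k%:R) (eta' ^+ j * t)) ^+ k].
    by near: t.
  have [UV V0] : meval (x t) U = meval (x t) V /\ meval (x t) V != 0.
    by near: t; apply: near0_dnbhs; apply: filterS hchart => t [].
  have xt0 : forall j, x t j != 0 by near: t; exact: near0_dnbhs.
  have [den0 ->] := hval _ UV V0 xt0; split=> //.
    by exists (g t), (b t); split=> //; near: t; exact: near0_dnbhs.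
  congr ((_ * _) ^+ _); apply: eq_bigr => j _.
  have -> : fuss_fun tau ((- m)%:~R / k%:R) (eta' ^+ j * t) = X (eta' ^+ j * t) ^ (- m).
    by move: (j); near: t; exact: near0_dnbhs.
  rewrite /x /root_chart expfzMl mulrA.
  suff -> : (eta ^ m) ^+ j * (eta ^+ j) ^ (- m) = 1 by rewrite mul1r.
  by rewrite !exprnP !exprz_exp -expfzDr // mulrN (mulrC m) subrr expr0z.
split.
- by move=> j; exact: analytic0_fuss_fun.
- exact: hcone.
have hgood : \forall t \near (0 : C), [/\ meval (x t) U = meval (x t) V,
    meval (x t) V != 0, forall j, x t j != 0, X t != 0 & X t ^+ k = 1 + t * X t ^ e].
  near=> t; have [UV V0] : meval (x t) U = meval (x t) V /\ meval (x t) V != 0.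
    by near: t; apply: filterS hchart => t [].
  split=> //; first by near: t.
    by near: t; exact: near_fuss_neq0.
  by near: t; exact: near_fuss_root.
(* If x s = l x t, the degrees of U and V give l ^ k = 1, and l = X s / X t is
   close to 1. *)
apply: filterS3 near_fuss_sep (cvg_fst hgood) (cvg_snd hgood) => -[s t] /= sep.
move=> [UVs Vs xs0 Xs0 Xsk] [UVt Vt xt0 Xt0 Xtk] l hl.
pose j0 := Ordinal k_gt0.
have x0E u : x u j0 = X u by rewrite /x /root_chart !expr0 !mul1r.
have l0 : l != 0.
  by apply/eqP => l0; move: (xs0 j0); rewrite hl l0 mul0r eqxx.
have xsE : x s = (fun i => l * x t i) by apply/funext.
have lk : l ^+ k = 1.
  move: UVs; rewrite xsE (meval_scale _ _ Ud) (meval_scale _ _ Vd) UVt.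
  move=> /(mulIf Vt); rewrite dE exprD -[RHS]mulr1.
  by apply: mulfI; rewrite expf_neq0.
have Xst : X s = X t.
  by apply: sep; have := hl j0; rewrite !x0E => ->; rewrite exprMn lk mul1r.
(* The equation X^k = 1 + t X^e recovers t from X. *)
move: Xsk; rewrite Xst Xtk => /addrI /mulIf h; apply: esym; apply: h.
by rewrite expfz_neq0.
Unshelve. all: by end_near. Qed.

End Chart.

(** * Roots of unity, and the expansion at infinity (ii) *)

Section Infinity.
Variable C : numClosedFieldType.
Hypothesis hC : geometric_complete C.

(** In characteristic 0 the polynomial ['X^k - 1] is separable, so it has k distinct roots, enough
    for [has_prim_root]. *)
Lemma prim_root_exists k : (0 < k)%N -> exists w : C, k.-primitive_root w.
Proof.
move=> k0; have [r rE] := closed_field_poly_normal ('X^k - 1 : {poly C}).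
rewrite (monicP (monicXnsubC _ k0)) scale1r in rE.
have r_uniq : uniq r.
  by rewrite -separable_prod_XsubC -rE separable_Xn_sub_1 // pnatr_eq0 -lt0n.
have r_unity : all k.-unity_root r.
  by apply/allP => z; rewrite -root_prod_XsubC -rE.
have r_size : (k <= size r)%N.
  by rewrite -ltnS -(size_prod_XsubC r id) -rE size_XnsubC.
by have /hasP[w _ hw] := has_prim_root k0 r_unity r_uniq r_size; exists w.
Qed.

Lemma cvg_exprn T (F : set_system T) (FF : Filter F) (f : T -> C) (l : C) n :
  f x @[x --> F] --> l -> f x ^+ n @[x --> F] --> l ^+ n.
Proof.
move=> cf; elim: n => [|n IH]; first exact: cvg_cst.
have -> : (fun u => f u ^+ n.+1) = f \* (fun u => f u ^+ n).
  by apply/funext => u /=; rewrite exprS.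
by rewrite exprS; exact: (cvgM cf IH).
Qed.

Lemma cvg_monomial_dnbhs (c : C) n : c != 0 -> (0 < n)%N ->
  (c * t ^+ n) @[t --> (0 : C)^'] --> (0 : C)^'.
Proof.
move=> c0 n0 P hP.
have hP0 : \forall w \near (0 : C), w != 0 -> P w := hP.
have h : (c * t ^+ n) @[t --> (0 : C)] --> (0 : C).
  have h0 : t ^+ n @[t --> (0 : C)] --> (0 : C).
    have h1 := @cvg_exprn C (nbhs (0 : C)) _ id 0 n cvg_id.
    rewrite expr0n (gtn_eqF n0) in h1; exact: h1.
  have h1 := @cvgMl_cst C C (nbhs (0 : C)) _ _ c 0 h0.
  rewrite mulr0 in h1; exact: h1.
have h2 : \forall t \near (0 : C), c * t ^+ n != 0 -> P (c * t ^+ n) by exact: (h _ hP0).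
have h3 := near0_dnbhs h2.
suff : \forall t \near (0 : C)^', P (c * t ^+ n) by exact.
near=> t; have tP : c * t ^+ n != 0 -> P (c * t ^+ n) by near: t; exact: h3.
apply: tP; rewrite mulf_neq0 // expf_neq0 //.
by near: t; exact: nbhs_dnbhs_neq.
Unshelve. all: by end_near. Qed.

Variables p q : nat.
Hypotheses (p_gt0 : (0 < p)%N) (q_gt0 : (0 < q)%N) (pq_coprime : coprime p q).

Let n_gt0 : (0 < p + q)%N. Proof. by rewrite addn_gt0 p_gt0. Qed.
Lemma uniformized_at_infinity (m : int) :
  uniformized_by (fun z : C => Fn p q (m%:~R / (p + q)%:R) z^-1 ^+ (p + q))
    (at_infinity C) (schwarz_cycl C p q (p + q)).
Proof.
set n := (p + q)%N.
have n_gt1 : (1 < n)%N by rewrite /n -addn1 leq_add.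
rewrite /schwarz_cycl ifN ?neq_ltn ?n_gt1 ?orbT //.
have [eta eta_prim] := prim_root_exists n_gt0.
(* Primitive because gcd(p, p + q) = gcd(p, q) = 1. *)
have eta'_prim : n.-primitive_root (eta ^+ p).
  by rewrite (prim_root_exp_coprime _ eta_prim) /n /coprime gcdnDl.
(* By Vieta, [U] takes the value b at the n roots. *)
pose U : mpoly n C := - (-1) ^+ n *: \prod_j coord C j.
pose chart := @root_chart C n p eta (eta ^+ p).
have hroots : \forall t \near (0 : C), forall j, chart t j ^+ n = t * chart t j ^+ p + 1.
  apply: (@filter_forall _ _ _ (nbhs (0 : C))) => j.
  apply: filterS (@near0_scale C ((eta ^+ p) ^+ j) _ (@near_fuss_root C hC n p n_gt0)) => t.
  (* With u = eta'^j t, the equation X(u)^n = 1 + u X(u)^p becomes the trinomial one, as eta^(jn) =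
     1 and eta'^j = eta^(jp). *)
  rewrite /chart /root_chart !exprMn => ->.
  rewrite [(eta ^+ j) ^+ n]exprAC (prim_expr_order eta_prim) expr1n mul1r.
  by rewrite -exprnP [(eta ^+ p) ^+ j]exprAC; ring.
have hinj := @near_root_chart_inj C hC n p eta (eta ^+ p) eta_prim.
apply: (@uniformized_by_schwarz C hC n p n_gt0 eta (eta ^+ p) eta_prim p q q_gt0 _ _ m
  U 1 n 0%N id (fun=> 1) (fun t => zeta_of p q 1 t)) => //.
- apply: dhomogZ; have := @dhomog_prod_const C n predT (@coord C n) 1 _.
  by rewrite muln1 -[#|predT|]/(#|'I_n|) card_ord; apply=> j; exact: dhomog_coord.
- exact: dhomog1.
- move=> s x _ _; rewrite !meval1 !mulr1 !mevalZ !rmorph_prod /=; congr (_ * _).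
  rewrite [RHS](reindex_inj (@perm_inj _ s)) /=.
  by apply: eq_bigr => j _; rewrite !meval_coord.
- near=> t; rewrite oner_neq0 orbT; split=> //.
  + by near: t.
  + rewrite meval1 mevalZ rmorph_prod /=.
    under eq_bigr do rewrite meval_coord.
    rewrite mulNr (@prod_trinomial_roots C p q t 1) ?opprK //.
    by apply: trinomial_roots_uniq => //; near: t.
  + by rewrite meval1 oner_neq0.
- move=> P hP; have hP0 : \forall w \near (0 : C)^', P w^-1 := hP.
  have h : \forall t \near (0 : C)^', P ((zeta_of p q 1 1)^-1 * t ^+ n)^-1.
    exact: (cvg_monomial_dnbhs (invr_neq0 (zeta_of11_neq0 C p_gt0 q_gt0)) n_gt0 hP0).
  suff : \forall t \near (0 : C)^', P (zeta_of p q 1 t) by exact.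
  apply: filterS h => t; rewrite invfM invrK !zeta_ofE //.
  by rewrite !expr1n !divr1 mulr1 div1r.
- pose a : C := m%:~R / n%:R; pose B := `|a| + `|p%:R / n%:R| + 1.
  have B1 : 1 <= B by rewrite lerDr addr_ge0.
  near=> t; split=> //; first by near: t; exact: nbhs_dnbhs_neq.
  rewrite (@Fn_average C hC p q p_gt0 q_gt0 a B (eta ^+ p) t) //; last first.
    by near: t; apply: near0_dnbhs; exact: near0_small.
  by rewrite mulrNz mulNr.
Unshelve. all: by end_near. Qed.

End Infinity.

(** * The expansion at zero (i), for q > 1 *)

Section Zero.
Variable C : numClosedFieldType.
Hypothesis hC : geometric_complete C.
Variables p q : nat.
Hypotheses (p_gt0 : (0 < p)%N) (q_gt0 : (0 < q)%N) (pq_coprime : coprime p q).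

Lemma cvg_zeta_at_zero : zeta_of p q t 1 @[t --> (0 : C)^'] --> at_zero C.
Proof.
have z0 := zeta_of11_neq0 C p_gt0 q_gt0.
have -> : (fun t : C => zeta_of p q t 1) = (fun t => zeta_of p q 1 1 * t ^+ q).
  by apply/funext => t; rewrite !zeta_ofE // !expr1n !divr1 mulr1.
exact: cvg_monomial_dnbhs.
Qed.

Lemma near_Fq_average (m : int) w : q.-primitive_root w ->
  \forall t \near (0 : C), Fq p q (m%:~R / q%:R) (zeta_of p q t 1) =
    q%:R^-1 * \sum_(j < q) fuss_fun ((- p%:Z)%:~R / q%:R) ((- m)%:~R / q%:R) (w ^+ j * t).
Proof.
move=> hw; pose a : C := m%:~R / q%:R; pose B := `|a| + `|- p%:R / q%:R| + 2.
have B1 : 1 <= B by rewrite (le_trans (ler1n C 2)) // lerDr addr_ge0.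
near=> t; rewrite (@Fq_average C hC p q p_gt0 q_gt0 a B w t) //; last first.
  by near: t; exact: near0_small.
by rewrite !mulrNz !mulNr.
Unshelve. all: by end_near. Qed.

Lemma uniformized_at_zero (m : int) : (1 < q)%N ->
  uniformized_by (fun z : C => Fq p q (m%:~R / q%:R) z ^+ q)
    (at_zero C) (schwarz_cycl C p q q).
Proof.
move=> q_gt1; rewrite /schwarz_cycl ifN ?neq_ltn ?q_gt1 ?orbT //.
have [eta eta_prim] := prim_root_exists C q_gt0.
(* This is eta^(-p), written with a natural exponent. *)
pose eta' := eta ^+ (p * q.-1).
have eta'_prim : q.-primitive_root eta'.
  by rewrite (prim_root_exp_coprime _ eta_prim) coprimeMl pq_coprime coprimePn.
have eta'E : eta ^+ p * eta' = 1.
  by rewrite -exprD -mulnS prednK // mulnC exprM (prim_expr_order eta_prim) expr1n.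
have eta0 : eta != 0 by rewrite (prim_root_eq0 eta_prim) -lt0n.
pose j0 := Ordinal q_gt0; pose j1 := Ordinal q_gt1.
(* U / V recovers g from two roots: x_0^(p+q) - x_1^(p+q) = g (x_0^p - x_1^p). The second root
   exists because q > 1. *)
pose U : mpoly q C := coord C j0 ^+ (p + q) - coord C j1 ^+ (p + q).
pose V : mpoly q C := coord C j0 ^+ p - coord C j1 ^+ p.
have UE x : meval x U = x j0 ^+ (p + q) - x j1 ^+ (p + q).
  by rewrite mevalB !rmorphXn /= !meval_coord.
have VE x : meval x V = x j0 ^+ p - x j1 ^+ p.
  by rewrite mevalB !rmorphXn /= !meval_coord.
pose chart := @root_chart C q (- p%:Z) eta eta'.
have hX0 : \forall t \near (0 : C), forall j : 'I_q,
    fuss_fun ((- p%:Z)%:~R / q%:R) q%:R^-1 (eta' ^+ j * t) != 0.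
  apply: (@filter_forall _ _ _ (nbhs (0 : C))) => j.
  exact: (@near0_scale C (eta' ^+ j) _ (@near_fuss_neq0 C hC q (- p%:Z))).
have hroots : \forall t \near (0 : C), forall j,
    chart t j ^+ (p + q) = 1 * chart t j ^+ p + t.
  apply: (@filter_forall _ _ _ (nbhs (0 : C))) => j.
  apply: filterS2 hX0 (@near0_scale C (eta' ^+ j) _ (@near_fuss_root C hC q (- p%:Z) q_gt0)) => t X0.
  (* With u = eta'^j t, Y^q = 1 + u Y^(-p) gives Y^(p+q) = Y^p + u; multiplying by eta^(j(p+q)) =
     eta^(jp) turns u into t. *)
  rewrite /chart /root_chart !exprMn.
  set Y := fuss_fun _ _ _ => Yq; have Y0 : Y != 0 by exact: X0.
  rewrite [Y ^+ (p + q)]exprD Yq exprD -exprnN mulrDr mulr1 mul1r.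
  rewrite [(eta ^+ j) ^+ q]exprAC (prim_expr_order eta_prim) expr1n mulr1.
  rewrite mulrDr; congr (_ + _); rewrite [(eta ^+ j) ^+ p]exprAC.
  have Yp0 : Y ^+ p != 0 by rewrite expf_neq0.
  rewrite [Y ^+ p * _]mulrC divfK // mulrA -exprMn eta'E expr1n.
  by rewrite mul1r.
apply: (@uniformized_by_schwarz C hC q (- p%:Z) q_gt0 eta eta' eta_prim p q q_gt0 _ _ m
  U V (p + q)%N p (fun=> 1) id (fun t => zeta_of p q t 1)) => //.
- by apply: rpredB; exact: dhomog_coordX.
- by apply: rpredB; exact: dhomog_coordX.
- by move=> s x _ hx; rewrite !UE !VE /=; exact: schwarz_slope_invariant.
- have hV : \forall t \near (0 : C), meval (chart t) V != 0.
    (* The limit is 1 - eta^p, nonzero because q > 1 is prime to p. *)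
    apply: (@near_neq C _ ((eta ^+ j0) ^+ p - (eta ^+ j1) ^+ p)).
      have -> : (fun t => meval (chart t) V) = (fun t => chart t j0 ^+ p - chart t j1 ^+ p).
        by apply/funext => t; rewrite VE.
      by apply: (@cvgB C C C (nbhs (0 : C))); apply: (@cvg_exprn C C (nbhs (0 : C)));
        exact: root_chart_cvg.
    rewrite subr_eq0 /= expr0 expr1 expr1n eq_sym -(prim_order_dvd eta_prim).
    apply/negP => /gcdn_idPr qp; move: pq_coprime; rewrite /coprime qp => /eqP q1.
    by move: (q_gt1); rewrite q1.
  near=> t; have ht j : chart t j ^+ (p + q) = 1 * chart t j ^+ p + t.
    by move: j; near: t.
  rewrite oner_neq0; split=> //; last by near: t.
  by rewrite UE VE !ht; ring.
- exact: cvg_zeta_at_zero.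
- near=> t; split=> //.
  by congr (_ ^+ _); near: t; apply: near0_dnbhs; exact: near_Fq_average.
Unshelve. all: by end_near. Qed.


End Zero.

(** * The expansion at zero for q = 1 *)

Section Line.
Variable C : numClosedFieldType.
Hypothesis hC : geometric_complete C.

Lemma analytic0B (f g : C -> C) : analytic0 f -> analytic0 g ->
  analytic0 (fun t => f t - g t).
Proof.
move=> [c hc] [d hd]; exists (fun i => c i - d i).
apply: filterS2 hc hd => t ct dt.
rewrite (_ : series _ = (fun N => series (fun i => c i * t ^+ i) N -
    series (fun i => d i * t ^+ i) N)); first exact: cvgB.
apply/funext => N; rewrite !seriesEnat /= -sumrB; apply: eq_bigr => i _.
by rewrite mulrBl.
Qed.

Lemma function_on_line (cmap : ('I_2 -> C) -> C -> Prop) (m : int) :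
  exists num den : mpoly 2 C,
    @function_on_quotient C (Curve [set x | exists i, x i != 0] cmap [set 1%g]) num den /\
    forall x, x ord_max != 0 -> x ord_max - x ord0 != 0 ->
      meval x den != 0 /\
      meval x num / meval x den = ((x ord_max - x ord0) / x ord_max) ^ m.
Proof.
pose E : mpoly 2 C := coord C ord_max; pose D : mpoly 2 C := E - coord C ord0.
have Ed : E \is ishomog1 1 mdeg by exact: dhomog_coord.
have Dd : D \is ishomog1 1 mdeg by apply: rpredB; exact: dhomog_coord.
have EE x : meval x E = x ord_max by exact: meval_coord.
have DE x : meval x D = x ord_max - x ord0 by rewrite mevalB !meval_coord.
(* The point s = 0, where neither form vanishes. *)
pose x0 (j : 'I_2) : C := (j == ord_max)%:R.
have x0m : x0 ord_max = 1 by rewrite /x0 eqxx.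
have x00 : x0 ord0 = 0 by [].
have hfun num den d : num \is ishomog1 d mdeg -> den \is ishomog1 d mdeg ->
    meval x0 den != 0 ->
    @function_on_quotient C (Curve [set x | exists i, x i != 0] cmap [set 1%g]) num den.
  move=> nd dd den0; split; first by exists d.
    by exists x0 => //; exists ord_max; rewrite x0m oner_neq0.
  move=> s x /set1P -> _.
  by have -> : x \o (1%g : 'S_2) = x by apply/funext => j /=; rewrite perm1.
case: m => L.
  exists (D ^+ L), (E ^+ L); split.
    apply: (hfun _ _ (1 * L)%N); try exact: dhomogMn.
    by rewrite rmorphXn /= EE x0m expr1n oner_neq0.
  move=> x xm xD; rewrite !rmorphXn /= EE DE expf_neq0 //; split=> //.
  by rewrite -exprnP exprMn exprVn.
exists (E ^+ L.+1), (D ^+ L.+1); split.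
  apply: (hfun _ _ (1 * L.+1)%N); try exact: dhomogMn.
  by rewrite rmorphXn /= DE x0m x00 subr0 expr1n oner_neq0.
move=> x xm xD; rewrite !rmorphXn /= EE DE expf_neq0 //; split=> //.
by rewrite NegzE -exprnN exprMn exprVn invfM invrK mulrC.
Qed.

(* In terms of the affine coordinate s = x_0 / x_1 the function is (1 - s)^m, and
   1 - s = X^-1. *)
Lemma uniformized_at_zero_line p (m : int) : (0 < p)%N ->
  uniformized_by (fun z : C => Fq p 1 (m%:~R / 1%:R) z ^+ 1)
    (at_zero C) (schwarz_cycl C p 1 1).
Proof.
move=> p_gt0; rewrite /schwarz_cycl eqxx.
have [w hw] := prim_root_exists C (ltn0Sn 0).
pose tau : C := (- p%:Z)%:~R / 1%:R; pose X := fuss_fun tau 1%:R^-1.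
(* The inverse of X, taken as A_(-1) so that it is analytic as a Fuss series. *)
pose Y := fuss_fun tau ((- 1)%:~R / 1%:R).
have hroot : \forall t \near (0 : C), X t ^+ 1 = 1 + t * X t ^ (- p%:Z).
  exact: (@near_fuss_root C hC 1 (- p%:Z)).
have hX0 : \forall t \near (0 : C), X t != 0 by exact: (@near_fuss_neq0 C hC 1 (- p%:Z)).
have hY : \forall t \near (0 : C), Y t = (X t)^-1.
  exact: (@near_fuss_exp C hC 1 (- p%:Z) (- 1)).
have hXm : \forall t \near (0 : C), fuss_fun tau ((- m)%:~R / 1%:R) t = X t ^ (- m).
  exact: (@near_fuss_exp C hC 1 (- p%:Z) (- m)).
have hF := near_Fq_average hC p_gt0 (ltn0Sn 0) m hw.
pose x (t : C) (j : 'I_2) : C := if j == ord0 then 1 - Y t else 1.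
have xm t : x t ord_max = 1 by [].
have x0 t : x t ord0 = 1 - Y t by [].
have [num [den [hnd hval]]] := function_on_line (line_cover p 1) m.
exists num, den; split=> //; exists x; split.
  split.
  - have a1 : analytic0 (fun=> 1 : C).
      have := analytic0_fuss_fun hC tau 0 1 1.
      by congr analytic0; apply/funext => t; rewrite fuss_fun0 mulr1.
    move=> j; rewrite /x; case: (j == ord0) => //=.
    apply: analytic0B => //.
    have := analytic0_fuss_fun hC tau ((- 1)%:~R / 1%:R) 1 1.
    by congr analytic0; apply/funext => t; rewrite !mul1r.
  - by near=> t; exists ord_max; rewrite xm oner_neq0.
  - have hgood : \forall t \near (0 : C), [/\ X t != 0, Y t = (X t)^-1 &
        X t ^+ 1 = 1 + t * X t ^ (- p%:Z)].
      exact: filterS3 hX0 hY hroot.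
    apply: (@filterS2 _ (filter_prod (nbhs (0 : C)) (nbhs (0 : C))) _ _ _ _ _
      (cvg_fst hgood) (cvg_snd hgood)) => -[s t] /=.
    move=> [Xs0 Ys Xs] [Xt0 Yt Xt] l hl.
    have l1 : l = 1 by have := hl ord_max; rewrite !xm mulr1 => <-.
    have Yst : Y s = Y t by have := hl ord0; rewrite !x0 l1 mul1r => /addrI /oppr_inj.
    have Xst : X s = X t by apply: invr_inj; rewrite -Ys -Yt.
    move: Xs; rewrite Xst Xt => /addrI /mulIf h; apply: esym; apply: h.
    by rewrite expfz_neq0.
exists (fun t => zeta_of p 1 t 1); first exact: cvg_zeta_at_zero.
apply: near0_dnbhs; near=> t.
have X0 : X t != 0 by near: t.
have Yt : Y t = (X t)^-1 by near: t.
have Xt : X t ^+ 1 = 1 + t * X t ^ (- p%:Z) by near: t.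
have xD : x t ord_max - x t ord0 = (X t)^-1 by rewrite xm x0 opprB addrC subrK.
(* With s = 1 - X^(-1), the root equation gives s / (1 - s)^(p+1) = X^p (X - 1) = t. *)
have hcover : line_cover p 1 (x t) (zeta_of p 1 t 1).
  rewrite /line_cover !xm !x0 oner_neq0 divr1; split=> //.
    by rewrite -subr_eq0 addrAC subrr sub0r oppr_eq0 Yt invr_eq0.
  rewrite /= subKr Yt !zeta_ofE //; congr (_ * _); rewrite !expr1 expr1n divr1.
  move: Xt; rewrite expr1 -exprnN => Xt.
  rewrite exprVn invrK addn1 exprSr mulrBl mul1r mulrCA mulVf // mulr1.
  have Xp0 : X t ^+ p != 0 by rewrite expf_neq0.
  by rewrite {2}Xt mulrDr mulr1 addrAC subrr add0r mulrCA divff // mulr1.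
have [den0 ->] : meval (x t) den != 0 /\
    meval (x t) num / meval (x t) den = ((x t ord_max - x t ord0) / x t ord_max) ^ m.
  by apply: hval; rewrite ?xD ?invr_eq0 // xm oner_neq0.
split=> //; rewrite xD xm.
have -> : Fq p 1 (m%:~R / 1%:R) (zeta_of p 1 t 1) =
    1%:R^-1 * \sum_(j < 1) fuss_fun tau ((- m)%:~R / 1%:R) (w ^+ j * t) by near: t.
rewrite big_ord1 expr0 [1 * t]mul1r.
have -> : fuss_fun tau ((- m)%:~R / 1%:R) t = X t ^ (- m) by near: t.
by rewrite invr1 mulr1 mul1r expr1 exprz_inv.
Unshelve. all: by end_near. Qed.

End Line.

Theorem theorem8p7 (R : realType) (p q : nat) (m : int)
    (p_gt0 : (0 < p)%N) (q_gt0 : (0 < q)%N) (pq_coprime : coprime p q) :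
  let n := (p + q)%N in
  uniformized_by (fun z : Cplx R => Fq p q (m%:~R / q%:R) z ^+ q)
    (at_zero (Cplx R)) (schwarz_cycl (Cplx R) p q q) /\
  uniformized_by (fun z : Cplx R => Fn p q (m%:~R / n%:R) z^-1 ^+ n)
    (at_infinity (Cplx R)) (schwarz_cycl (Cplx R) p q n).
Proof.
have hC := @geometric_complete_Cplx R.
split; last exact: uniformized_at_infinity.
(* For q = 1 the curve is by definition the projective line with its own covering map. *)
move: q_gt0; rewrite leq_eqVlt => /predU1P[<-|q_gt1].
  exact: uniformized_at_zero_line.
by apply: uniformized_at_zero => //; exact: ltnW.
Qed.
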